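(* Let $T\ge 1$, $n\ge 2$, $d\ge 1$, $\boldsymbol\mu\in\mathbb{R}^d$, let $\boldsymbol\Sigma\in\mathbb{R}^{d\times d}$ be positive definite, let $\mathbf{z}^*\in\mathbb{R}^d$ and $\tau\in\{1,\dots,T\}$ be fixed. Data consist of $T$ batches $D_1,\dots,D_T$, batch $D_t$ consisting of $n$ points $\mathbf{X}_{t,1},\dots,\mathbf{X}_{t,n}\in\mathbb{R}^d$. Under the hypothesis $\mathbf{H_0}$ all $nT$ points are i.i.d. $\mathcal{N}(\boldsymbol\mu,\boldsymbol\Sigma)$. Under the hypothesis $\mathbf{H_1^\tau}$ the points are generated in the same way and then the $J$-th point of $D_\tau$ is replaced by $\mathbf{z}^*$, where $J$ is uniform on $\{1,\dots,n\}$ and independent of the data. The observations are the cumulative empirical means $\hat{\boldsymbol\mu}_t=\frac{1}{nt}\sum_{j=1}^t\sum_{k=1}^n\mathbf{X}_{j,k}$, $t=1,\dots,T$. Let $\bar{\mathbf{X}}_\tau=\frac1n\sum_{k=1}^n\mathbf{X}_{\tau,k}=\tau\hat{\boldsymbol\mu}_\tau-(\tau-1)\hat{\boldsymbol\mu}_{\tau-1}$ (with $\hat{\boldsymbol\mu}_0:=0$) and $\mathbf{N_\tau}=\bar{\mathbf{X}}_\tau-\boldsymbol\mu$. Then the logarithm $\log\mathrm{LR}_\tau$ of the ratio of the joint density of $(\hat{\boldsymbol\mu}_1,\dots,\hat{\boldsymbol\mu}_T)$ under $\mathbf{H_1^\tau}$ to its joint density under $\mathbf{H_0}$ satisfies \[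 \log\mathrm{LR}_\tau=-\frac d2\log\Big(\frac{n-1}{n}\Big)-\frac{n}{2(n-1)}\mathbf{N_\tau}^\top\boldsymbol\Sigma^{-1}\mathbf{N_\tau}+\frac{n}{n-1}\mathbf{N_\tau}^\top\boldsymbol\Sigma^{-1}(\mathbf{z}^*-\boldsymbol\mu)-\frac{m^*}{2(n-1)}, \] where $m^*=(\mathbf{z}^*-\boldsymbol\mu)^\top\boldsymbol\Sigma^{-1}(\mathbf{z}^*-\boldsymbol\mu)$.
   Context: This is the likelihood ratio for a membership inference test that observes the whole sequence of empirical means and knows the insertion time $\tau$ of the target $\mathbf{z}^*$. *)

(* Defs.v *)
From HB Require Import structures.
From mathcomp Require Import all_boot all_order all_algebra.
From mathcomp Require Import all_classical all_reals all_analysis.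
Set Implicit Arguments. Unset Strict Implicit. Unset Printing Implicit Defensive.
Import Order.TTheory GRing.Theory Num.Def Num.Theory.
Import numFieldNormedType.Exports.
Local Open Scope classical_set_scope.
Local Open Scope ring_scope.

Section defs.
Context {R : realType}.

Definition qform d (A : 'M[R]_d) (u v : 'rV[R]_d) : R := (u *m A *m v^T) 0 0.

Definition posdef d (S : 'M[R]_d) : Prop :=
  S^T = S /\ forall v : 'rV[R]_d, v != 0 -> 0 < qform S v v.

Definition bdd_fun (U : Type) (f : U -> R) : Prop :=
  exists M : R, forall x, `|f x| <= M.

(* X is a random vector with law N(mu, S), S positive definite
   (Cramer-Wold characterisation: every nonzero linear projection <X,v>
   is measurable and has law N(<mu,v>, v S v^T); the standard deviation
   argument of normal_prob is sqrt(v S v^T) > 0). *)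
Definition gaussian_vec {dO} {O : measurableType dO} (P : probability O R)
  d (X : O -> 'rV[R]_d) (mu : 'rV[R]_d) (S : 'M[R]_d) : Prop :=
  (forall i, measurable_fun setT (fun w => X w 0 i)) /\
  forall v : 'rV[R]_d, v != 0 -> forall A : set R, measurable A ->
    P ((fun w => qform 1%:M (X w) v) @^-1` A)
    = normal_prob (qform 1%:M mu v) (Num.sqrt (qform S v v)) A.

Definition indep_family {dO} {O : measurableType dO} (P : probability O R)
  (I : finType) d (X : I -> O -> 'rV[R]_d) : Prop :=
  forall (S : {set I}) (f : I -> 'rV[R]_d -> R),
    (forall i, continuous (f i)) -> (forall i, bdd_fun (f i)) ->
    (\int[P]_w (\prod_(i in S) f i (X i w))%:E
     = \prod_(i in S) \int[P]_w (f i (X i w))%:E)%E.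

Definition indep_label {dO} {O : measurableType dO} (P : probability O R)
  (I : finType) d n (X : I -> O -> 'rV[R]_d) (J : O -> 'I_n) : Prop :=
  forall (S : {set I}) (f : I -> 'rV[R]_d -> R) (k : 'I_n),
    (forall i, continuous (f i)) -> (forall i, bdd_fun (f i)) ->
    (\int[P]_w ((J w == k)%:R * \prod_(i in S) f i (X i w))%:E
     = P [set w | J w = k] * \int[P]_w (\prod_(i in S) f i (X i w))%:E)%E.

Definition uniform_label {dO} {O : measurableType dO} (P : probability O R)
  n (J : O -> 'I_n) : Prop :=
  forall k : 'I_n, measurable [set w | J w = k] /\
                   P [set w | J w = k] = (n%:R^-1)%:E.

(* cumulative empirical means: row t (0-based) is  hat mu_{t+1} *)
Definition cum_means T n d (x : 'I_T -> 'I_n -> 'rV[R]_d) : 'M[R]_(T, d) :=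
  \matrix_(t < T) (((n * t.+1)%:R)^-1 *:
     \sum_(j < T | (j <= t)%N) \sum_(k < n) x j k).

Definition replace_point T n d (x : 'I_T -> 'I_n -> 'rV[R]_d) (tau : 'I_T)
  (j : 'I_n) (z : 'rV[R]_d) : 'I_T -> 'I_n -> 'rV[R]_d :=
  fun t k => if (t == tau) && (k == j) then z else x t k.

Definition ord_prev T (t : 'I_T) : 'I_T :=
  Ordinal (leq_ltn_trans (leq_pred t) (ltn_ord t)).

(* bar X_tau = tau hatmu_tau - (tau-1) hatmu_{tau-1}  (with hatmu_0 := 0);
   tau is 0-based here, so this is (tau+1) row tau - tau row (tau-1). *)
Definition batch_mean T d (M : 'M[R]_(T, d)) (tau : 'I_T) : 'rV[R]_d :=
  (tau.+1)%:R *: row tau M - (tau : nat)%:R *: row (ord_prev tau) M.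

Definition logLR T n d (mu : 'rV[R]_d) (Sigma : 'M[R]_d) (z : 'rV[R]_d)
  (tau : 'I_T) (M : 'M[R]_(T, d)) : R :=
  let N := batch_mean M tau - mu in
  let Si := invmx Sigma in
  - (d%:R / 2) * ln ((n - 1)%:R / n%:R)
  - n%:R / (2 * (n - 1)%:R) * qform Si N N
  + n%:R / (n - 1)%:R * qform Si N (z - mu)
  - qform Si (z - mu) (z - mu) / (2 * (n - 1)%:R).

End defs.

(* Main.v *)
Require Import Defs.
From HB Require Import structures.
From mathcomp Require Import all_boot all_order all_algebra.
From mathcomp Require Import all_classical all_reals all_analysis.
From mathcomp Require Import measurable_realfun.
From mathcomp Require Import ring lra.
Set Implicit Arguments.
Unset Strict Implicit.
Unset Printing Implicit Defensive.
Import Order.TTheory GRing.Theory Num.Def Num.Theory.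
Import numFieldNormedType.Exports.
Local Open Scope classical_set_scope.
Local Open Scope ring_scope.

(** Whitening the batch means by a matrix [W] with [W Sigma W^T = 1] turns the
    claim into a statement on independent standard normal coordinates: under
    the alternative only the batch [tau] changes, its coordinates becoming
    N(zeta_i / sqrt n, (n - 1) / n) with [zeta = (z - mu) W^T], and [expR logLR]
    is the product over the coordinates of the corresponding ratios of normal
    densities. Both sides of the identity are compared by characteristic
    functions, i.e. by testing against the functions [x |-> cos (<A, x> + th)].
    These determine the integrals of all bounded continuous functions, even for
    signed bounded weights, because trigonometric polynomials form an algebra
    and [h x] is the iterated boundedly pointwise limit, first in the degree and
    then in [L], of the Bernstein polynomials of [h] evaluated at
    [L sin (x / L)]. *)

(** * The Gaussian characteristic function *)

Section normal.
Context {R : realType}.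
Notation leb := (@lebesgue_measure R).

(** The hypotheses reach the points only through one-dimensional projections and through
    expectations of products of bounded continuous functions, so no joint density is formed. Cosines
    with a free phase suit both: the phase lets one real identity carry the real and imaginary parts
    of a characteristic function, and addition formulas turn the cosine of a sum into sums of
    products of cosines. The variance [(n - 1) / n] arises because each of the [n] points carries a
    share [1 / n] of the unit variance of a whitened batch coordinate, and the replaced point, now
    constant, loses its share while shifting the mean by [zeta_i / sqrt n]. As this variance is
    below 1, the density ratio is bounded. The result is the same for every label, so averaging over
    [J] changes nothing. Signed weights enter because coordinates are tilted one at a time, the
    factor that carries the others being a cosine. *)

Lemma integral_normal_prob (m s : R) (f : _ -> \bar R) :
  (normal_prob m s).-integrable setT f ->
  (\int[normal_prob m s]_x f x = \int[leb]_x (f x * (normal_pdf m s x)%:E))%E.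
Proof.
move=> fi; have mf := measurable_int _ fi.
rewrite -(Radon_Nikodym_change_of_variables (normal_prob_dominates m s))//=.
apply: ae_eq_integral => //=.
- apply: emeasurable_funM => //; apply: (measurable_int leb).
  by apply: Radon_Nikodym_integrable; exact: normal_prob_dominates.
- apply: emeasurable_funM => //; apply/measurableT_comp => //=.
  exact: measurable_normal_pdf.
(* The Radon-Nikodym derivative is determined only almost everywhere; it agrees with [normal_pdf]
   there because both integrate to [normal_prob] on every measurable set. *)
- apply: ae_eqe_mul2l => /=.
  rewrite Radon_NikodymE//=; first exact: normal_prob_dominates.
  move=> nm; case: cid => /= h [h1 h2 h3].
  apply: integral_ae_eq => //=.
  + by apply/measurableT_comp => //=; exact: measurable_normal_pdf.
  + by move=> E _ mE; rewrite -h3.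
Qed.

Lemma is_derive_normal_pdf (m s x : R) : s != 0 ->
  is_derive x 1 (normal_pdf m s) (- (x - m) / s ^+ 2 * normal_pdf m s x).
Proof.
move=> s0; rewrite normal_pdfE// /normal_fun.
pose k : R := - (s ^+ 2 *+ 2)^-1.
have -> : (fun x0 : R => normal_peak s * expR (- (x0 - m) ^+ 2 / (s ^+ 2 *+ 2)))
  = normal_peak s \*: (expR \o (k \*: ((id - cst m) ^+ 2))).
  apply/funext => y; congr (_ * expR _). rewrite /k /= /GRing.scale/= !fctE.
  by field.
apply: is_derive_eq.
rewrite /= /k /GRing.scale/= !fctE /=.
have -> : - (s ^+ 2 *+ 2)^-1 * (x - m) ^+ 2 = - (x - m) ^+
  2 / (s ^+ 2 *+ 2) by field.
by field.
Qed.

(* From [2 t <= 1 + t ^ 2 <= expR (t ^ 2)] with [t = `|x - m| / (2 s)]. *)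
Lemma normal_pdf_tail (m s x : R) : 0 < s ->
  `|x - m| * normal_pdf m s x <=
  s * normal_peak s / normal_peak (2 * s) * normal_pdf m (2 * s) x.
Proof.
move=> s0; have s20 : 0 < 2 * s by rewrite mulr_gt0.
rewrite !normal_pdfE ?gt_eqF// [leRHS]mulrA divfK ?gt_eqF ?normal_peak_gt0
  ?gt_eqF//.
rewrite mulrCA [leRHS]mulrAC [leRHS]mulrC ler_wpM2l ?normal_peak_ge0// /normal_fun.
set y := x - m.
have h : `|y| <= s * expR (y ^+ 2 / (s ^+ 2 *+ 4)).
  rewrite -ler_pdivrMl// (le_trans _ (expR_ge1Dx _))//.
  rewrite -(real_normK (num_real y)).
  have -> : `|y| ^+ 2 / (s ^+ 2 *+ 4) = (s^-1 * `|y| / 2) ^+ 2 by field;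
    rewrite gt_eqF.
  have := sqr_ge0 (s^-1 * `|y| / 2 - 1); nra.
apply: (le_trans (ler_wpM2r (expR_ge0 _) h)).
rewrite -mulrA -expRD ler_pM2l// ler_expR.
have -> : y ^+ 2 / (s ^+ 2 *+ 4) + - y ^+ 2 / (s ^+ 2 *+ 2) =
  - (y ^+ 2 / s ^+ 2) / 4 by field; rewrite gt_eqF.
have -> : - y ^+ 2 / ((2 * s) ^+ 2 *+ 2) = - (y ^+ 2 / s ^+ 2) / 8 by field;
  rewrite gt_eqF.
have : 0 <= y ^+ 2 / s ^+ 2 by rewrite divr_ge0 ?sqr_ge0.
lra.
Qed.

(* The integrals over [-n, n] are differences of values of [H]. *)
Lemma Rintegral_derive_vanish (H h : R -> R) :
  (forall x : R, is_derive x 1 H (h x)) -> continuous h ->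
  leb.-integrable setT (EFin \o h) ->
  H n.+1%:R @[n --> \oo] --> (0 : R) -> H (- n.+1%:R) @[n --> \oo] --> (0 : R) ->
  \int[leb]_x h x = 0.
Proof.
move=> dH ch ih Hp Hm.
pose D (n : nat) : set R := `[- n.+1%:R, n.+1%:R]%classic.
have ftc n : (\int[leb]_x ((h \_ (D n)) x)%:E = (H n.+1%:R - H (- n.+1%:R))%:E)%E.
  rewrite EFinB -(@continuous_FTC2 _ h H).
  - rewrite [RHS]integral_mkcond; apply: eq_integral => x _.
    by rewrite /= restrict_EFin.
  - by rewrite gtrN.
  - exact: continuous_subspaceT.
  - have cH : continuous H.
      move=> x; apply: differentiable_continuous; apply/derivable1_diffP.
      by have [] := dH x.
    split.
    + by move=> x _; have [] := dH x.
    + exact/cvg_at_right_filter/cH.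
    + exact/cvg_at_left_filter/cH.
  - by move=> x _; rewrite derive1E; have [_ ->] := dH x.
have c1 : (\int[leb]_x ((h \_ (D n)) x)%:E)%E @[n --> \oo] -->
  (\int[leb]_x (h x)%:E)%E.
  apply: (@dominated_cvg _ _ _ leb setT _ (fun n x => ((h \_ (D n)) x)%:E)
    (EFin \o h) (fun x => `|h x|%:E)) => //.
  - move=> n; apply/measurable_EFinP; apply/(measurable_restrictT _ _).1 => //.
      exact: measurable_itv.
    by apply: measurable_funTS; exact: continuous_measurable_fun.
  - move=> x _; apply: cvg_near_cst; near=> n.
    rewrite /= patchE mem_set// /D /= in_itv/= -ler_norml.
    apply: (@le_trans _ _ n%:R); last by rewrite ler_nat.
    by near: n; exact: nbhs_infty_ger.
  - exact: (integrable_abse ih).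
  - move=> n x _; rewrite lee_fin patchE; case: ifPn => // _.
    by rewrite normr0.
have c2 : (\int[leb]_x ((h \_ (D n)) x)%:E)%E @[n --> \oo] --> 0%:E.
  under eq_fun do rewrite ftc.
  apply: cvg_EFin; first exact: nearW.
  rewrite -[X in _ --> X](subr0 (0:R)); exact: cvgB.
rewrite /Rintegral.
by rewrite -(cvg_lim _ c1)// (cvg_lim _ c2).
Unshelve. all: by end_near. Qed.

Lemma integrable_scaled_normal_pdf (m s C : R) :
  leb.-integrable setT (fun x => (C * normal_pdf m s x)%:E).
Proof.
under eq_fun do rewrite EFinM.
by apply: integrableZl => //; exact: integrable_normal_pdf.
Qed.

(** The density of deviation [2 * s] is at most its peak, so the tail bound leaves
    [s * normal_peak s] divided by the distance to [m]. *)
Lemma cvg_normal_pdf_at (m s : R) (a : nat -> R) : 0 < s ->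
  `|a n - m| @[n --> \oo] --> +oo -> normal_pdf m s (a n) @[n --> \oo] --> (0 : R).
Proof.
move=> s0 ay; have s20 : 2 * s != 0 by rewrite mulf_neq0 ?gt_eqF.
pose C := s * normal_peak s.
apply: (@squeeze_cvgr _ _ _ _ (cst 0) (fun n => C * `|a n - m|^-1)); last 2 first.
- exact: cvg_cst.
- rewrite -[X in _ --> X](mulr0 C); apply: cvgM; first exact: cvg_cst.
  apply/gtr0_cvgV0 => //.
  move/cvgryPgt : ay; exact.
near=> n; rewrite normal_pdf_ge0/=.
have an : 0 < `|a n - m|.
  by near: n; move/cvgryPgt : ay; exact.
rewrite ler_pdivlMr// mulrC (le_trans (normal_pdf_tail _ _ s0))//.
rewrite -mulrA ler_piMr ?mulr_ge0 ?normal_peak_ge0 ?(ltW s0)//.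
by rewrite ler_pdivrMl ?mulr1 ?normal_pdf_ub ?normal_peak_gt0.
Unshelve. all: by end_near. Qed.

Section charfun.
Variables (m s eta : R).
Hypothesis s0 : 0 < s.
(** [G] is an integrable majorant of [(x - m) * sin (ph u x) * normal_pdf m s x] that does not
    depend on [u], as differentiation under the integral requires. *)
Let C := s * normal_peak s / normal_peak (2 * s).
Let G x := C * normal_pdf m (2 * s) x.
Let sn0 : s != 0. Proof. by rewrite gt_eqF. Qed.

Let ph (u x : R) := u * (x - m) + eta.

Let cph u : continuous (ph u).
Proof.
move=> x; apply: cvgD; last exact: cvg_cst.
apply: cvgM; first exact: cvg_cst.
by apply: cvgB; [exact: cvg_id|exact: cvg_cst].
Qed.

Let ccos u : continuous (fun x => cos (ph u x) * normal_pdf m s x).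
Proof.
move=> x; apply: cvgM; last exact: continuous_normal_pdf.
by apply: continuous_comp; [exact: cph|exact: continuous_cos].
Qed.

Let cxsin u : continuous (fun x => (x - m) * sin (ph u x) * normal_pdf m s x).
Proof.
move=> x; apply: cvgM; last exact: continuous_normal_pdf.
apply: cvgM; first by apply: cvgB; [exact: cvg_id|exact: cvg_cst].
by apply: continuous_comp; [exact: cph|exact: continuous_sin].
Qed.

Let icos u : leb.-integrable setT
  (EFin \o (fun x => cos (ph u x) * normal_pdf m s x)).
Proof.
apply: (@le_integrable _ _ _ leb _ _ _ (fun x => (normal_pdf m s x)%:E)) => //.
- by apply/measurable_EFinP; exact: continuous_measurable_fun.
- move=> x _; rewrite lee_fin normrM !(ger0_norm (normal_pdf_ge0 _ _ _)).
  by rewrite ler_piMl ?normal_pdf_ge0// cos_max.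
- exact: integrable_normal_pdf.
Qed.

Let bxsin u x : `|(x - m) * sin (ph u x) * normal_pdf m s x| <= G x.
Proof.
rewrite !normrM (ger0_norm (normal_pdf_ge0 _ _ _)).
apply: le_trans (normal_pdf_tail m x s0).
by rewrite ler_wpM2r ?normal_pdf_ge0// ler_piMr// sin_max.
Qed.

Let G0 x : 0 <= G x.
Proof. exact: le_trans (normr_ge0 _) (bxsin 0 x). Qed.

Let ixsin u : leb.-integrable setT
  (EFin \o (fun x => (x - m) * sin (ph u x) * normal_pdf m s x)).
Proof.
apply: (@le_integrable _ _ _ leb _ _ _ (fun x => (G x)%:E)) => //.
- by apply/measurable_EFinP; exact: continuous_measurable_fun.
- by move=> x _; rewrite lee_fin (ger0_norm (G0 x)) bxsin.
- exact: integrable_scaled_normal_pdf.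
Qed.

Let K u := \int[leb]_x (cos (ph u x) * normal_pdf m s x).

Let sp (u x : R) : is_derive x 1 (fun x => sin (ph u x)) (cos (ph u x) * u).
Proof.
have -> : (fun x => sin (ph u x)) = sin \o (u \*: (id - cst m) + cst eta).
  by apply/funext.
apply: is_derive_eq.
by rewrite /GRing.scale/= subr0 addr0 mulr1.
Qed.

(* Integration by parts (Stein's identity); it makes the characteristic function
   [K] solve [K' u = - s ^ 2 u K u]. *)
Let stein u : \int[leb]_x ((x - m) * sin (ph u x) * normal_pdf m s x) = s ^+
  2 * u * K u.
Proof.
pose H x := sin (ph u x) * normal_pdf m s x.
pose h x := u * (cos (ph u x) * normal_pdf m s x) - (s ^+ 2)^-1 *
  ((x - m) * sin (ph u x) * normal_pdf m s x).
have i1 : leb.-integrable setT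
  (EFin \o (fun x => u * (cos (ph u x) * normal_pdf m s x))).
  by rewrite /comp; under eq_fun do rewrite EFinM; apply: integrableZl => //;
    exact: icos.
have i2 : leb.-integrable setT
  (EFin \o (fun x => (s ^+ 2)^-1 * ((x - m) * sin (ph u x) * normal_pdf m s x))).
  by rewrite /comp; under eq_fun do rewrite EFinM; apply: integrableZl => //;
    exact: ixsin.
(* [h] is the derivative of [H], and [H] vanishes at both ends since it is dominated by the
   density. *)
have : \int[leb]_x h x = 0.
  have Hb x : `|H x| <= normal_pdf m s x.
    rewrite normrM (ger0_norm (normal_pdf_ge0 _ _ _)).
    by rewrite ler_piMl ?normal_pdf_ge0// sin_max.
  have Hc (a : nat -> R) : `|a n - m| @[n --> \oo] --> +oo ->
    H (a n) @[n --> \oo] --> (0 : R).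
    move=> ay; apply: norm_cvg0.
    apply: (@squeeze_cvgr _ _ _ _ (cst 0) (fun n => normal_pdf m s (a n))).
    - by apply: nearW => n; rewrite normr_ge0 Hb.
    - exact: cvg_cst.
    - exact: cvg_normal_pdf_at.
  apply: (@Rintegral_derive_vanish H h).
  - move=> x.
    have dp := is_derive_normal_pdf m x sn0.
    have ds := sp u x.
    have -> : H = (fun x => sin (ph u x)) * normal_pdf m s by [].
    apply: is_derive_eq.
    rewrite /h /GRing.scale/=; field; exact: sn0.
  - move=> x; apply: cvgB; apply: cvgM => //;
      [exact: cvg_cst|exact: ccos|exact: cvg_cst|exact: cxsin].
  - rewrite /h /comp; under eq_fun do rewrite EFinB.
    exact: integrableB.
  - apply: Hc; apply/cvgryPge => M; near=> n.
    apply: (@le_trans _ _ (n.+1%:R - m)); last exact: ler_norm.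
    rewrite lerBrDr (@le_trans _ _ n%:R) ?ler_nat//.
    by near: n; exact: nbhs_infty_ger.
  - apply: Hc; apply/cvgryPge => M; near=> n.
    rewrite -normrN opprB (@le_trans _ _ (m - - n.+1%:R)) ?ler_norm//.
    rewrite opprK -lerBlDl (@le_trans _ _ n%:R) ?ler_nat//.
    by near: n; exact: nbhs_infty_ger.
rewrite /h RintegralB// !RintegralZl// => /eqP; rewrite subr_eq0 => /eqP e.
rewrite -mulrA -/(K u) in e *; rewrite e mulrA divff ?mul1r//.
by rewrite expf_neq0.
Unshelve. all: by end_near. Qed.

Let dK (u : R) : is_derive u 1 K (- (s ^+ 2 * u * K u)).
Proof.
pose f (v x : R) := cos (ph v x) * normal_pdf m s x.
have df (v x : R) :
  is_derive v 1 (f ^~ x) (- ((x - m) * sin (ph v x) * normal_pdf m s x)).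
  have -> : f ^~ x = normal_pdf m s x \*: (cos \o ((x - m) \*: id + cst eta)).
    apply/funext => w; rewrite /f /ph [LHS]mulrC [in LHS](mulrC w). by rewrite /=
      /GRing.scale/= !fctE.
  apply: is_derive_eq.
  rewrite /GRing.scale/= /ph addr0 mulr1 (mulrC v); ring.
have d1 (v x : R) : partial1of2 f v x =
  - ((x - m) * sin (ph v x) * normal_pdf m s x).
  by rewrite partial1of2E; have [_ ->] := df v x.
have ei : \int[leb]_x partial1of2 f u x = - (s ^+ 2 * u * K u).
  rewrite -stein; under eq_Rintegral do rewrite d1 -mulN1r.
  by rewrite RintegralZl// mulN1r.
(* The radius 1 is arbitrary: [G] dominates the partial derivative for all parameters. *)
have Iu : [set` `]u - 1, u + 1[ ] u by rewrite /= in_itv/= ltrBlDr ltrDl ltr01.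
have if_ v : [set` `]u - 1, u + 1[ ] v -> leb.-integrable setT (EFin \o f v)
  by move=> _; exact: icos.
have df' v x : [set` `]u - 1, u + 1[ ] v -> setT x -> derivable (f ^~ x) v 1.
  by move=> _ _; have [] := df v x.
have iG : leb.-integrable setT (EFin \o G) by exact: integrable_scaled_normal_pdf.
have bG v x : [set` `]u - 1, u + 1[ ] v -> setT x -> `|partial1of2 f v x| <= G x.
  by move=> _ _; rewrite d1 normrN bxsin.
apply: DeriveDef.
  exact: (derivable_under_integral measurableT Iu if_ df' G0 iG bG).
rewrite -ei -derive1E.
exact: (differentiation_under_integral measurableT Iu if_ df' G0 iG bG).
Qed.

(** By the differential equation, [expR (s ^+ 2 * u ^+ 2 / 2) * K u] has zero derivative; its value
    at [u = 0] is [cos eta] times the total mass of the density. *)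
Lemma Rintegral_cos_normal_pdf u :
  \int[leb]_x (cos (u * (x - m) + eta) * normal_pdf m s x)
  = expR (- (s ^+ 2 * u ^+ 2 / 2)) * cos eta.
Proof.
rewrite -/(K u).
pose L u := expR (s ^+ 2 * u ^+ 2 / 2) * K u.
have dL (v : R) : is_derive v 1 L 0.
  have -> : L = (expR \o ((s ^+ 2 / 2) \*: (id ^+ 2))) * K.
    by apply/funext => w; rewrite /L !fctE/= /GRing.scale/= mulrAC.
  have := dK v => ?.
  apply: is_derive_eq.
  rewrite /GRing.scale/= !fctE/=; by field.
have : L u = L 0 by exact: is_derive_0_is_cst.
rewrite {2}/L expr0n/= mulr0 mul0r expR0 mul1r.
have -> : K 0 = cos eta.
  rewrite /K; under eq_Rintegral do rewrite /ph mul0r add0r.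
  rewrite RintegralZl//; last by apply: integrable_normal_pdf.
  by rewrite /Rintegral integral_normal_pdf mulr1.
by rewrite /L expRN => <-; rewrite mulKf// gt_eqF// expR_gt0.
Qed.
End charfun.

Lemma Rintegral_normal_prob (m s : R) (f : _ -> R) :
  (normal_prob m s).-integrable setT (EFin \o f) ->
  \int[normal_prob m s]_x f x = \int[leb]_x (f x * normal_pdf m s x).
Proof.
by move=> fi; rewrite /Rintegral integral_normal_prob.
Qed.

End normal.

(** * Bernstein polynomials *)

Section bernstein.
Context {R : realType}.

(* ['C(m, k) y ^ k (1 - y) ^ (m - k)], by Pascal's rule *)
Fixpoint bern_weight (m k : nat) (y : R) : R :=
  match m with
  | 0 => (k == 0%N)%:R
  | m'.+1 => (1 - y) * bern_weight m' k y +
    y * (if k is k'.+1 then bern_weight m' k' y else 0)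
  end.

Lemma bern_gt m k y : (m < k)%N -> bern_weight m k y = 0.
Proof.
elim: m k => [|m IH] [|k]//= mk.
by rewrite !IH ?mulr0 ?addr0// ltnW.
Qed.

Lemma bern_ge0 m k y : 0 <= y <= 1 -> 0 <= bern_weight m k y.
Proof.
move=> /andP[y0 y1]; elim: m k => [|m IH] k /=; first exact: ler0n.
rewrite addr_ge0 ?mulr_ge0 ?subr_ge0//.
by case: k => [|k].
Qed.

(** Conditioning a binomial count on one more trial: the count stays with probability [1 - y] and
    rises by one with probability [y]. The moments below follow by induction from this. *)
Lemma sum_bernS m y (phi : nat -> R) :
  \sum_(k < m.+2) bern_weight m.+1 k y * phi k =
  (1 - y) * (\sum_(k < m.+1) bern_weight m k y * phi k) +
  y * (\sum_(k < m.+1) bern_weight m k y * phi k.+1).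
Proof.
under eq_bigr do rewrite [bern_weight _.+1 _ _]/= mulrDl.
rewrite big_split/=; congr (_ + _).
- rewrite big_ord_recr/= bern_gt// mulr0 mul0r addr0 mulr_sumr.
  by apply: eq_bigr => i _; rewrite mulrA.
- rewrite big_ord_recl/= mulr0 mul0r add0r mulr_sumr.
  by apply: eq_bigr => i _; rewrite mulrA.
Qed.

Lemma sum_bern m y : \sum_(k < m.+1) bern_weight m k y = 1.
Proof.
under eq_bigr do rewrite -[bern_weight _ _ _]mulr1.
elim: m => [|m IH]; first by rewrite big_ord1 mulr1.
by rewrite (sum_bernS m y (fun=> 1)) IH; ring.
Qed.

(** The centre [a] is free because a success in the inductive step moves it to [a - 1]. *)
Lemma sum_bern_sqr m y a :
  \sum_(k < m.+1) bern_weight m k y * (k%:R - a) ^+ 2 =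
  m%:R * y * (1 - y) + (m%:R * y - a) ^+ 2.
Proof.
elim: m a => [|m IH] a; first by rewrite big_ord1/=; ring.
rewrite (sum_bernS m y (fun k => (k%:R - a) ^+ 2)) IH.
have e (k : nat) : k.+1%:R - a = k%:R - (a - 1) by rewrite -natr1; ring.
under [X in _ + _ * X]eq_bigr do rewrite e.
by rewrite IH -natr1; ring.
Qed.

Lemma sum_bern_var m y : 0 <= y <= 1 ->
  \sum_(k < m.+2) bern_weight m.+1 k y * (k%:R / m.+1%:R - y) ^+ 2 <= m.+1%:R^-1.
Proof.
move=> /andP[y0 y1].
have m0 : (m.+1%:R : R) != 0 by rewrite pnatr_eq0.
have -> : \sum_(k < m.+2) bern_weight m.+1 k y * (k%:R / m.+1%:R - y) ^+ 2 =
  (m.+1%:R ^+ 2)^-1 *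
    (\sum_(k < m.+2) bern_weight m.+1 k y * (k%:R - m.+1%:R * y) ^+ 2).
  rewrite mulr_sumr; apply: eq_bigr => i _.
  have -> : i%:R / m.+1%:R - y = m.+1%:R^-1 * (i%:R - m.+1%:R * y).
    by rewrite mulrBr mulKf// mulrC.
  by rewrite exprMn exprVn mulrCA.
rewrite sum_bern_sqr subrr expr0n/= addr0 !mulrA.
have -> : (m.+1%:R ^+ 2)^-1 * m.+1%:R =
  m.+1%:R^-1 :> R by rewrite expr2 invfM -mulrA mulVf ?mulr1.
rewrite -mulrA ler_piMr ?invr_ge0//; nra.
Qed.

Section multi.
Variable I : finType.

(** The tensor-product Bernstein operator on the unit cube; the degree [m.+1] in each variable keeps
    the grid step nonzero. *)
Definition bernstein (m : nat) (F : (I -> R) -> R) (y : I -> R) : R :=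
  \sum_(g : {ffun I -> 'I_m.+2})
    F (fun i => (g i)%:R / m.+1%:R) * \prod_i bern_weight m.+1 (g i) (y i).

Lemma sum_bern_prod m (y : I -> R) :
  \sum_(g : {ffun I -> 'I_m.+2}) \prod_i bern_weight m.+1 (g i) (y i) = 1.
Proof.
rewrite -(bigA_distr_bigA (fun i (k : 'I_m.+2) => bern_weight m.+1 k (y i))).
by apply: big1 => i _; exact: sum_bern.
Qed.

(** The weights form a product law: the square is absorbed into the factor of coordinate [c], and
    every other factor sums to 1. *)
Lemma sum_bern_prod_var m (y : I -> R) (c : I) : (forall i, 0 <= y i <= 1) ->
  \sum_(g : {ffun I -> 'I_m.+2}) ((g c)%:R / m.+1%:R - y c) ^+
    2 * \prod_i bern_weight m.+1 (g i) (y i)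
  <= m.+1%:R^-1.
Proof.
move=> y01.
pose H i (k : 'I_m.+2) :=
  bern_weight m.+1 k (y i) * (if i == c then (k%:R / m.+1%:R - y c) ^+ 2 else 1).
rewrite [leLHS](_ : _ = \sum_(g : {ffun I -> 'I_m.+2}) \prod_i H i (g i));
  last first.
  apply: eq_bigr => g _; rewrite /H big_split/= mulrC; congr (_ * _).
  by rewrite -big_mkcond/= big_pred1_eq.
rewrite -(bigA_distr_bigA H) (bigD1 c)//=.
have -> : \prod_(i | i != c) \sum_j H i j = 1.
  apply: big1 => i ic; under eq_bigr do rewrite /H (negbTE ic) mulr1.
  exact: sum_bern.
rewrite mulr1.
by under eq_bigr do rewrite /H eqxx; exact: sum_bern_var.
Qed.

(** Bernstein's argument through Chebyshev's inequality; only continuity at the point [y] enters. *)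
Lemma cvg_bernstein (F : (I -> R) -> R) (M : R) (y : I -> R) :
  (forall v, `|F v| <= M) -> (forall i, 0 <= y i <= 1) ->
  (forall e : R, 0 < e -> exists2 d : R, 0 < d &
    forall v, (forall i, `|v i - y i| < d) -> `|F v - F y| <= e) ->
  bernstein m F y @[m --> \oo] --> F y.
Proof.
move=> FM y01 Fc.
apply/cvgrPdist_le => e e0.
have e20 : 0 < e / 2 by rewrite divr_gt0.
have [d d0 Fd] := Fc _ e20.
have M0 : 0 <= M by apply: le_trans (FM y).
pose K := 2 * M / d ^+ 2.
have K0 : 0 <= K by rewrite /K divr_ge0 ?sqr_ge0// mulr_ge0.
(* Near [y] continuity yields [e / 2]. Elsewhere some coordinate is off by at least [d], and [K] is
   chosen so that its square alone already pays for the trivial bound [2 * M]. *)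
have key v : `|F v - F y| <= e / 2 + K * \sum_i (v i - y i) ^+ 2.
  have S0 : 0 <= \sum_i (v i - y i) ^+ 2 by apply: sumr_ge0 => i _; exact: sqr_ge0.
  have [/forallP h|/forallPn[i hi]] := boolP [forall i, `|v i - y i| < d].
    by apply: (le_trans (Fd _ h)); rewrite lerDl mulr_ge0.
  apply: (@le_trans _ _ (2 * M)).
    by rewrite (le_trans (ler_normB _ _))// mulr2n mulrDl mul1r lerD.
  apply: (@le_trans _ _ (K * \sum_i (v i - y i) ^+ 2));
    last by rewrite lerDr divr_ge0// ltW.
  rewrite /K -mulrA ler_peMr ?mulr_ge0// ler_pdivlMl ?exprn_gt0// mulr1.
  rewrite (bigD1 i)//= -[(v i - y i) ^+ 2]real_normK ?num_real//.
  rewrite -[leLHS]addr0 lerD//; last by apply: sumr_ge0 => j _; exact: sqr_ge0.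
  by rewrite ler_sqr ?nnegrE ?(ltW d0)// leNgt.
have bnd m : `|F y - bernstein m F y| <= e / 2 + K * #|I|%:R / m.+1%:R.
  pose P (g : {ffun I -> 'I_m.+2}) := \prod_i bern_weight m.+1 (g i) (y i).
  have P0 g : 0 <= P g by apply: prodr_ge0 => i _; exact: bern_ge0.
  have -> : F y - bernstein m F y =
    - \sum_(g : {ffun I -> 'I_m.+2}) (F (fun i => (g i)%:R / m.+1%:R) - F y) * P g.
    under eq_bigr do rewrite mulrBl.
    by rewrite sumrB -mulr_sumr sum_bern_prod mulr1 opprB.
  rewrite normrN (le_trans (ler_norm_sum _ _ _))//.
  apply: (@le_trans _ _
    (\sum_(g : {ffun I -> 'I_m.+2})
    (e / 2 + K * \sum_i ((g i)%:R / m.+1%:R - y i) ^+ 2) * P g)).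
    by apply: ler_sum => g _; rewrite normrM (ger0_norm (P0 _)) ler_wpM2r.
  under eq_bigr do rewrite mulrDl -(mulrA K) mulr_suml.
  rewrite big_split/= -!mulr_sumr sum_bern_prod mulr1 lerD2l -mulrA ler_wpM2l//.
  rewrite exchange_big/= (@le_trans _ _ (\sum_(i : I) m.+1%:R^-1))//.
    by apply: ler_sum => i _; exact: sum_bern_prod_var.
  by rewrite sumr_const mulr_natl.
near=> m; apply: (le_trans (bnd m)).
rewrite [leRHS]splitr lerD2l ler_pdivrMr// -ler_pdivrMl ?divr_gt0//.
apply: (@le_trans _ _ m%:R); last by rewrite ler_nat.
by near: m; exact: nbhs_infty_ger.
Unshelve. all: by end_near. Qed.
End multi.
End bernstein.

(** * Trigonometric polynomials *)

Section bounded_integration.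
Context {R : realType} {dO : measure_display} {O : measurableType dO}.
Variable P : probability O R.

Lemma integrable_bdd (f : O -> R) : measurable_fun setT f -> bdd_fun f ->
  P.-integrable setT (EFin \o f).
Proof.
move=> mf [M fM]; apply: measurable_bounded_integrable => //.
  by rewrite (le_lt_trans (probability_le1 _ _))// ltry.
exists M; split; first exact: num_real.
by move=> x Mx y _ /=; rewrite (le_trans (fM y))// ltW.
Qed.

Lemma cvg_Rintegral_bdd (f_ : nat -> O -> R) (f : O -> R) (M : R) :
  (forall n, measurable_fun setT (f_ n)) -> (forall n x, `|f_ n x| <= M) ->
  (forall x, f_ n x @[n --> \oo] --> f x) ->
  \int[P]_x f_ n x @[n --> \oo] --> \int[P]_x f x.
Proof.
move=> mf fM cf; apply: fine_cvg; rewrite fineK; last first.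
  apply: integrable_fin_num => //; apply: integrable_bdd.
    by apply: (measurable_fun_cvg mf) => x _; exact: cf.
  exists M => x; have cn : `|f_ n x| @[n --> \oo] --> `|f x| by apply: cvg_norm;
    exact: cf.
  rewrite -(cvg_lim _ cn)//; apply: limr_le; last exact: nearW.
  by apply/cvg_ex; eexists; exact: cn.
apply: (@dominated_cvg _ _ _ P setT _ (fun n x => (f_ n x)%:E) (EFin \o f)
  (fun=> M%:E)) => //.
- by move=> n; exact/measurable_EFinP.
- by move=> x _; apply: cvg_EFin; [exact: nearW|exact: cf].
- by apply: (@integrable_bdd (cst M)) => //; exists `|M|.
- by move=> n x _; rewrite lee_fin.
Qed.

Lemma EFin_Rintegral_bdd (f : O -> R) : measurable_fun setT f -> bdd_fun f ->
  (\int[P]_x (f x)%:E)%E = (\int[P]_x f x)%:E.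
Proof.
by move=> mf bf; rewrite /Rintegral fineK//; apply: integrable_fin_num => //;
  exact: integrable_bdd.
Qed.

End bounded_integration.

Section bdd.
Context {R : realType}.
Lemma bdd_funD (U : Type) (f g : U -> R) : bdd_fun f -> bdd_fun g ->
  bdd_fun (fun x => f x + g x).
Proof.
by move=> [M fM] [N gN]; exists (M + N) => x;
  rewrite (le_trans (ler_normD _ _))// lerD.
Qed.

Lemma bdd_funM (U : Type) (f g : U -> R) : bdd_fun f -> bdd_fun g ->
  bdd_fun (fun x => f x * g x).
Proof.
by move=> [M fM] [N gN]; exists (M * N) => x; rewrite normrM ler_pM.
Qed.

Lemma bdd_fun_cst (U : Type) (c : R) : bdd_fun (fun _ : U => c).
Proof. by exists `|c|. Qed.

Lemma bdd_fun_cos (U : Type) (f : U -> R) : bdd_fun (fun x => cos (f x)).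
Proof. by exists 1 => x; exact: cos_max. Qed.

Lemma bdd_fun_prod (U : Type) (I : Type) (r : seq I) (Q : pred I)
  (f : I -> U -> R) :
  (forall i, bdd_fun (f i)) -> bdd_fun (fun x => \prod_(i <- r | Q i) f i x).
Proof.
move=> bf; elim: r => [|i r IH].
  by under eq_fun do rewrite big_nil; exact: bdd_fun_cst.
under eq_fun do rewrite big_cons; case: (Q i) => //.
exact: bdd_funM.
Qed.
End bdd.

Section trig.
Context {R : realType} (p q : nat).
Implicit Types A x : 'M[R]_(p, q).

Definition mxdot A x : R := \sum_i \sum_j A i j * x i j.

Lemma mxdotDl A B x : mxdot (A + B) x = mxdot A x + mxdot B x.
Proof.
rewrite /mxdot -big_split; apply: eq_bigr => i _; rewrite -big_split/=.
by apply: eq_bigr => j _; rewrite mxE mulrDl.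
Qed.

Lemma mxdotNl A x : mxdot (- A) x = - mxdot A x.
Proof.
rewrite /mxdot -sumrN; apply: eq_bigr => i _; rewrite -sumrN.
by apply: eq_bigr => j _; rewrite mxE mulNr.
Qed.

Lemma mxdot0l x : mxdot 0 x = 0.
Proof. by rewrite /mxdot big1// => i _; rewrite big1// => j _;
  rewrite mxE mul0r. Qed.

Lemma mxdotZdelta c i j x : mxdot (c *: delta_mx i j) x = c * x i j.
Proof.
rewrite /mxdot (bigD1 i)//= [X in _ + X]big1 ?addr0; last first.
  by move=> k /negPf ki; apply: big1 => l _; rewrite !mxE ki/= mulr0 mul0r.
rewrite (bigD1 j)//= [X in _ + X]big1 ?addr0; last first.
  by move=> k /negPf kj; rewrite !mxE kj andbF mulr0 mul0r.
by rewrite !mxE !eqxx mulr1.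
Qed.

Lemma mxdotC A B : mxdot A B = mxdot B A.
Proof. by apply: eq_bigr => i _; apply: eq_bigr => j _; rewrite mulrC. Qed.

Lemma mxdot_sqrDdelta A (u : R) i j :
  mxdot (A + u *: delta_mx i j) (A + u *: delta_mx i j) =
  mxdot A A + 2 * u * A i j + u ^+ 2.
Proof.
by rewrite mxdotDl (mxdotC A) mxdotDl !mxdotZdelta !mxE !eqxx/=; ring.
Qed.

(** Taken as the linear span of shifted cosines, so that a linear identity need only be checked on
    [trig_cos]; stability under products is then proved in [trigM]. *)
Inductive trig : ('M[R]_(p, q) -> R) -> Prop :=
| trig_cos A th : trig (fun x => cos (mxdot A x + th))
| trigD f g : trig f -> trig g -> trig (fun x => f x + g x)
| trigZ c f : trig f -> trig (fun x => c * f x).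

Lemma trig_cst c : trig (fun=> c).
Proof.
have -> : (fun _ : 'M[R]_(p, q) => c) = (fun x => c * cos (mxdot 0 x + 0)).
  by apply/funext => x; rewrite mxdot0l addr0 cos0 mulr1.
exact/trigZ/trig_cos.
Qed.

Lemma cosMcos (a b : R) : cos a * cos b = 2^-1 * cos (a + b) + 2^-1 * cos (a - b).
Proof. by rewrite cosB cosD; field. Qed.

Lemma trigM f g : trig f -> trig g -> trig (fun x => f x * g x).
Proof.
move=> tf tg; elim: tf => [A th|f1 f2 _ IH1 _ IH2|c f1 _ IH]; last 2 first.
- by under eq_fun do rewrite mulrDl; exact: trigD.
- by under eq_fun do rewrite -mulrA; exact: trigZ.
elim: tg => [B et|g1 g2 _ IH1 _ IH2|c g1 _ IH]; last 2 first.
- by under eq_fun do rewrite mulrDr; exact: trigD.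
- by under eq_fun do rewrite mulrCA; exact: trigZ.
under eq_fun => x.
  rewrite cosMcos addrACA -mxdotDl opprD [X in _ + _ * cos X]addrACA -mxdotNl
    -mxdotDl.
  over.
by apply: trigD; apply: trigZ; exact: trig_cos.
Qed.

Lemma trig_sum (I : Type) (r : seq I) (F : I -> 'M[R]_(p, q) -> R) :
  (forall i, trig (F i)) -> trig (fun x => \sum_(i <- r) F i x).
Proof.
move=> tF; elim: r => [|i r IH].
  by under eq_fun do rewrite big_nil; exact: trig_cst.
by under eq_fun do rewrite big_cons; exact: trigD.
Qed.

Lemma trig_prod (I : Type) (r : seq I) (F : I -> 'M[R]_(p, q) -> R) :
  (forall i, trig (F i)) -> trig (fun x => \prod_(i <- r) F i x).
Proof.
move=> tF; elim: r => [|i r IH].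
  by under eq_fun do rewrite big_nil; exact: trig_cst.
by under eq_fun do rewrite big_cons; exact: trigM.
Qed.

Lemma trig_bern m k f : trig f -> trig (fun x => bern_weight m k (f x)).
Proof.
move=> tf; elim: m k => [|m IH] k /=; first exact: trig_cst.
apply: trigD; apply: trigM => //.
  apply: trigD; first exact: trig_cst.
  by under eq_fun do rewrite -mulN1r; exact: trigZ.
by case: k => [|k] //; exact: trig_cst.
Qed.

Lemma trig_sin c i j : trig (fun x => sin (c * x i j)).
Proof.
by under eq_fun do rewrite -cosBpihalf -mxdotZdelta; exact: trig_cos.
Qed.

Lemma bdd_trig f : trig f -> bdd_fun f.
Proof.
elim=> [A th|f1 f2 _ IH1 _ IH2|c f1 _ IH]; first exact: bdd_fun_cos.
- exact: bdd_funD.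
- by apply: bdd_funM => //; exact: bdd_fun_cst.
Qed.

End trig.

(** * Cosines determine weighted laws *)

Section uniqueness.
Context {R : realType}.

Lemma bernstein_bdd (I : finType) (F : (I -> R) -> R) (M : R) m (y : I -> R) :
  (forall v, `|F v| <= M) -> (forall i, 0 <= y i <= 1) -> `|bernstein m F y| <= M.
Proof.
move=> FM y01; rewrite /bernstein (le_trans (ler_norm_sum _ _ _))//.
rewrite -[leRHS]mulr1 -[X in _ <= M * X](sum_bern_prod m y) mulr_sumr.
apply: ler_sum => g _; rewrite normrM.
have P0 : 0 <= \prod_i bern_weight m.+1 (g i) (y i) by apply: prodr_ge0 => i _;
  exact: bern_ge0.
by rewrite (ger0_norm P0) ler_wpM2r.
Qed.

Lemma mx_continuousP p q (h : 'M[R]_(p, q) -> R) (x : 'M[R]_(p, q)) :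
  {for x, continuous h} ->
  forall e : R, 0 < e -> exists2 d : R, 0 < d &
    forall y : 'M[R]_(p, q), (forall i j, `|x i j - y i j| < d) -> `|h x - h y| < e.
Proof.
move=> hx e e0; have /cvgrPdist_lt/(_ _ e0) := hx.
move=> /nbhs_ballP[d /= d0 hd]; exists d => // y xy; apply: hd.
by split => // i j; exact: xy.
Qed.

(** These are the difference quotients at 0 of [t |-> sin (t * x)] along [t = 1 / (n + 1)]. *)
Lemma cvg_mulr_sin_divr (x : R) : n.+1%:R * sin (n.+1%:R^-1 * x) @[n --> \oo] --> x.
Proof.
pose f : R -> R := fun t => sin (t * x).
have df : is_derive (0 : R) 1 f x.
  have -> : f = sin \o (x \*: id).
    by apply/funext => t; rewrite /f/= /GRing.scale/= mulrC.
  apply: is_derive_eq.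
  by rewrite /GRing.scale/= scaler0 cos0 mul1r mulr1.
have [/cvg_ex[l fl] Dl] := df.
have lx : l = x by rewrite -Dl; apply/esym/cvg_lim.
move: fl; rewrite lx => /cvgr_dnbhsP/(_ (fun n => n.+1%:R^-1)) fl.
have /fl : (forall n, (n.+1%:R^-1 : R) != 0) /\ (n.+1%:R^-1 : R) @[n --> \oo] -->
  (0 : R).
  split; first by move=> n; rewrite invr_eq0 pnatr_eq0.
  exact: cvg_harmonic.
rewrite /f; under eq_fun do rewrite /GRing.scale/=
  mulr1 addr0 mul0r sin0 subr0 invrK.
exact.
Qed.

Section approx.
Context (p q : nat).
Variables (h : 'M[R]_(p, q) -> R) (M : R).
Hypotheses (ch : continuous h) (hM : forall x, `|h x| <= M).

(** [F L] reads [h] on the cube [[-L, L]] through the unit cube, and [y L x] is the point of the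
    unit cube that stands for [L sin (x / L)]. The sine makes a compact approximation apply to all
    [x] while staying trigonometric. *)
Let F (L : R) (v : 'I_p * 'I_q -> R) := h (\matrix_(i, j) (L * (2 * v (i, j) - 1))).
Let y (L : R) (x : 'M[R]_(p, q)) (c : 'I_p * 'I_q) : R :=
  2^-1 * (1 + sin (L^-1 * x c.1 c.2)).

Let y01 L x c : 0 <= y L x c <= 1.
Proof.
rewrite /y; have := sin_le1 (L^-1 * x c.1 c.2); have := sin_geN1 (L^-1 * x c.1 c.2).
lra.
Qed.

Let trig_approx_step L m : trig (fun x => bernstein m (F L) (y L x)).
Proof.
apply: trig_sum => g; apply: trigM; first exact: trig_cst.
apply: trig_prod => c; apply: trig_bern; apply: trigM; first exact: trig_cst.
by apply: trigD; [exact: trig_cst|exact: trig_sin].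
Qed.

Let cvg_bernstein_sin (L : R) (x : 'M[R]_(p, q)) : 0 < L ->
  bernstein m (F L) (y L x) @[m --> \oo] -->
    h (\matrix_(i, j) (L * sin (L^-1 * x i j))).
Proof.
move=> L0.
have Fy : F L (y L x) = h (\matrix_(i, j) (L * sin (L^-1 * x i j))).
  by congr h; apply/matrixP => i j; rewrite !mxE /y/=; field.
rewrite -Fy; apply: (@cvg_bernstein _ _ _ M) => //; first by move=> v; exact: hM.
move=> e e0.
have [d d0 hd] := mx_continuousP
  (@ch (\matrix_(i, j) (L * (2 * y L x (i, j) - 1)))) e0.
(* The change of variable in [F L] stretches each coordinate by [2 * L]. *)
exists (d / (2 * L)); first by rewrite divr_gt0// mulr_gt0.
move=> v vy; rewrite distrC ltW//; apply: hd => i j; rewrite !mxE.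
rewrite (_ : _ - _ = (2 * L) * (y L x (i, j) - v (i, j))); last by ring.
by rewrite normrM gtr0_norm ?mulr_gt0// distrC -ltr_pdivlMl ?mulr_gt0// mulrC vy.
Qed.

Let cvg_sin (x : 'M[R]_(p, q)) :
  h (\matrix_(i, j) (n.+1%:R * sin (n.+1%:R^-1 * x i j))) @[n --> \oo] --> h x.
Proof.
apply/cvgrPdist_lt => e e0.
have [d d0 hd] := mx_continuousP (@ch x) e0.
near=> n; apply: hd => i j; rewrite mxE.
move: i j; near: n; apply: filter_forall => i; apply: filter_forall => j.
by have /cvgrPdist_lt/(_ _ d0) := @cvg_mulr_sin_divr (x i j).
Unshelve. all: by end_near. Qed.

(** Stated as an induction principle since it serves twice: for the measurability of [h (Y w)] and
    for the equality of weighted integrals. Both limits keep the bound [M], as [bernstein] averages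
    values of its argument. *)
Lemma continuous_trig_ind (Q : ('M[R]_(p, q) -> R) -> Prop) :
  (forall f, trig f -> Q f) ->
  (forall (f_ : nat -> 'M[R]_(p, q) -> R) (f : 'M[R]_(p, q) -> R) (N : R),
    (forall n, Q (f_ n)) ->
     (forall n x, `|f_ n x| <= N) -> (forall x, f_ n x @[n --> \oo] --> f x) ->
       Q f) ->
  Q h.
Proof.
move=> Qtrig Qlim.
apply: (Qlim _ _ M _ _ cvg_sin) => [n|n x]; last exact: hM.
apply: (Qlim (fun m x => bernstein m (F n.+1%:R) (y n.+1%:R x)) _ M).
- by move=> m; exact/Qtrig/trig_approx_step.
- by move=> m x; apply: bernstein_bdd => // v; exact: hM.
- by move=> x; exact: cvg_bernstein_sin.
Qed.

End approx.

Lemma measurable_trig p q (dO : measure_display) (O : measurableType dO)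
    (Y : O -> 'M[R]_(p, q)) (f : 'M[R]_(p, q) -> R) :
  (forall i j, measurable_fun setT (fun w => Y w i j)) ->
  trig f -> measurable_fun setT (fun w => f (Y w)).
Proof.
move=> mY; elim=> [A th|f1 f2 _ m1 _ m2|c f1 _ m1].
- apply: measurableT_comp; first exact:
    continuous_measurable_fun (@continuous_cos R).
  apply: measurable_funD => //; apply: measurable_sum => i.
  by apply: measurable_sum => j; exact: measurable_funM.
- exact: measurable_funD.
- exact: measurable_funM.
Qed.

Lemma continuous_sumr (T : topologicalType) (I : Type) (r : seq I) (Q : pred I)
  (F : I -> T -> R) :
  (forall i, continuous (F i)) -> continuous (fun x => \sum_(i <- r | Q i) F i x).
Proof.
move=> cF; elim: r => [|i r IH].
  by under eq_fun do rewrite big_nil; exact: cst_continuous.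
under eq_fun do rewrite big_cons; case: (Q i) => //.
by move=> x; apply: cvgD; [exact: cF|exact: IH].
Qed.

Lemma continuous_mulcr (T : topologicalType) (c : R) (f : T -> R) :
  continuous f -> continuous (fun x => c * f x).
Proof. by move=> cf x; apply: cvgM; [exact: cvg_cst|exact: cf]. Qed.

Lemma continuous_addcr (T : topologicalType) (c : R) (f : T -> R) :
  continuous f -> continuous (fun x => c + f x).
Proof. by move=> cf x; apply: cvgD; [exact: cvg_cst|exact: cf]. Qed.

Lemma continuous_mxdot p q (A : 'M[R]_(p, q)) : continuous (mxdot A).
Proof.
apply: continuous_sumr => i; apply: continuous_sumr => j.
exact/continuous_mulcr/coord_continuous.
Qed.

Lemma measurable_continuous_mx p q (dO : measure_display) (O : measurableType dO)
    (Y : O -> 'M[R]_(p, q)) (h : 'M[R]_(p, q) -> R) :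
  (forall i j, measurable_fun setT (fun w => Y w i j)) ->
  continuous h -> bdd_fun h -> measurable_fun setT (fun w => h (Y w)).
Proof.
move=> mY ch [M hM].
apply: (continuous_trig_ind ch hM
  (Q := fun f => measurable_fun setT (fun w => f (Y w)))).
- by move=> f; exact: measurable_trig.
- move=> f_ f N mf _ cf.
  by apply: (measurable_fun_cvg mf) => w _; exact: cf.
Qed.

(** Used with [g1] a signed product of a cosine and a partial ratio, to split off one normal
    coordinate, and finally with weight 1 against the full likelihood ratio. *)
Lemma cos_uniqueness p q
    (d1 : measure_display) (O1 : measurableType d1) (P1 : probability O1 R)
    (d2 : measure_display) (O2 : measurableType d2) (P2 : probability O2 R)
    (Y1 : O1 -> 'M[R]_(p, q)) (Y2 : O2 -> 'M[R]_(p, q)) (g1 : O1 -> R)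
      (g2 : O2 -> R) :
  (forall i j, measurable_fun setT (fun w => Y1 w i j)) ->
  (forall i j, measurable_fun setT (fun w => Y2 w i j)) ->
  measurable_fun setT g1 -> bdd_fun g1 -> measurable_fun setT g2 -> bdd_fun g2 ->
  (forall A th, \int[P1]_w (cos (mxdot A (Y1 w) + th) * g1 w) =
                \int[P2]_w (cos (mxdot A (Y2 w) + th) * g2 w)) ->
  forall h : 'M[R]_(p, q) -> R, continuous h -> bdd_fun h ->
  \int[P1]_w (h (Y1 w) * g1 w) = \int[P2]_w (h (Y2 w) * g2 w).
Proof.
move=> mY1 mY2 mg1 bg1 mg2 bg2 Hcos h ch [M hM].
(* Measurability travels with the equality because additivity of the integral and dominated
   convergence consume it at each stage. *)
pose Q (f : 'M[R]_(p, q) -> R) := [/\ measurable_fun setT (fun w => f (Y1 w)),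
  measurable_fun setT (fun w => f (Y2 w)) &
  \int[P1]_w (f (Y1 w) * g1 w) = \int[P2]_w (f (Y2 w) * g2 w)].
suff : Q h by case.
apply: (continuous_trig_ind ch hM).
- have bY d' (O' : measurableType d') (P' : probability O' R)
    (Y' : O' -> 'M[R]_(p, q)) g' f :
    trig f -> measurable_fun setT (fun w => f (Y' w)) -> measurable_fun setT g' ->
      bdd_fun g' ->
    P'.-integrable setT (EFin \o (fun w => f (Y' w) * g' w)).
    move=> tf mf mg' bg'; apply: integrable_bdd; first exact: measurable_funM.
    by apply: bdd_funM => //; have [N fN] := bdd_trig tf; exists N.
  move=> f; elim=> [A th|f1 f2 t1 [m11 m12 e1] t2 [m21 m22 e2]|c f1 t1
    [m11 m12 e1]].
  + by split; [exact: measurable_trig (trig_cos _ _)..|exact: Hcos].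
  + split; [exact: measurable_funD..|].
    under eq_Rintegral do rewrite mulrDl.
    under [RHS]eq_Rintegral do rewrite mulrDl.
    by rewrite !RintegralD ?e1 ?e2//; exact: bY.
  + split; [exact: measurable_funM..|].
    under eq_Rintegral do rewrite -mulrA.
    under [RHS]eq_Rintegral do rewrite -mulrA.
    by rewrite !RintegralZl ?e1//; exact: bY.
- move=> f_ f N Qf fN cf.
  have mf1 : measurable_fun setT (fun w => f (Y1 w)).
    by apply: (@measurable_fun_cvg _ _ _ _ (fun n w => f_ n (Y1 w))) => [m|w _];
      [have [] := Qf m|exact: cf].
  have mf2 : measurable_fun setT (fun w => f (Y2 w)).
    by apply: (@measurable_fun_cvg _ _ _ _ (fun n w => f_ n (Y2 w))) => [m|w _];
      [have [] := Qf m|exact: cf].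
  split => //.
  have intlim d' (O' : measurableType d') (P' : probability O' R)
    (Y' : O' -> 'M[R]_(p, q)) g' :
    (forall n, measurable_fun setT (fun w => f_ n (Y' w))) ->
    measurable_fun setT g' -> bdd_fun g' ->
    \int[P']_w (f_ n (Y' w) * g' w) @[n --> \oo] --> \int[P']_w (f (Y' w) * g' w).
    move=> mf mg' [N' gN'].
    apply: (@cvg_Rintegral_bdd _ _ _ P' (fun n w => f_ n (Y' w) * g' w) _ (N * N')).
    - by move=> n; exact: measurable_funM.
    - by move=> n w; rewrite normrM ler_pM.
    - by move=> w; apply: cvgM; [exact: cf|exact: cvg_cst].
  have l1 := intlim _ _ P1 Y1 g1 (fun n => let: And3 a _ _ := Qf n in a) mg1 bg1.
  have l2 := intlim _ _ P2 Y2 g2 (fun n => let: And3 _ a _ := Qf n in a) mg2 bg2.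
  rewrite -(cvg_lim _ l1)// -(cvg_lim _ l2)//.
  suff -> : (fun n => \int[P1]_w (f_ n (Y1 w) * g1 w)) =
    (fun n => \int[P2]_w (f_ n (Y2 w) * g2 w)) by [].
  by apply/funext => n; have [] := Qf n.
Qed.

End uniqueness.

(** * Whitening *)

Section whitening.
Context {R : realType}.

(** Symmetric Gaussian elimination, which builds the inverse of a Cholesky factor: [L] clears the
    first row and column, and induction handles the remaining block. *)
Lemma whitening d (S : 'M[R]_d) : posdef S -> exists W : 'M[R]_d, W *m S *m W^T =
  1%:M.
Proof.
elim: d S => [|d IH] S [Ssym Spos]; first by exists 0; apply/matrixP => -[].
pose S' : 'M[R]_(1 + d) := S.
pose a := ulsubmx S'; pose b := ursubmx S'; pose C := drsubmx S'.
have S'sym : S'^T = S' by [].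
have blS : dlsubmx S' = b^T by rewrite -[in LHS]S'sym -trmx_ursub.
have Sb : S' = block_mx a b b^T C by rewrite -blS submxK.
have Csym : C^T = C by rewrite [in RHS]/C -[in RHS]S'sym -trmx_drsub.
have Spos' (v : 'rV[R]_(1 + d)) : v != 0 -> 0 < (v *m S' *m v^T) 0 0 by exact: Spos.
pose a0 := a 0 0.
have aE : a = a0%:M by rewrite [LHS]mx11_scalar.
have a0_gt0 : 0 < a0.
  have := Spos' (row_mx 1%:M 0).
  have -> : (row_mx 1%:M 0 : 'rV[R]_(1 + d)) != 0.
    by rewrite row_mx_eq0 negb_and matrix_nonzero1.
  move=> /(_ isT); rewrite Sb mul_row_block tr_row_mx mul_row_col.
  by rewrite !mul1mx !mul0mx !addr0 trmx1 trmx0 mulmx1 mulmx0 addr0.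
(* the Schur complement *)
pose C' := C - a0^-1 *: (b^T *m b).
pose L : 'M[R]_(1 + d) := block_mx 1%:M 0 (- (a0^-1 *: b^T)) 1%:M.
have LSL : L *m S' *m L^T = block_mx a 0 0 C'.
  have LT : L^T = block_mx 1%:M (a0^-1 *: - b) 0 1%:M.
    by rewrite tr_block_mx !trmx1 trmx0 -scalerN linearZ/= linearN/= trmxK.
  rewrite Sb LT /L -scalerN !mulmx_block.
  rewrite !mul1mx !mul0mx !mulmx1 !mulmx0 !addr0.
  have -> : a0^-1 *: - b^T *m a + b^T = 0.
    by rewrite aE mul_mx_scalar scalerA divff ?gt_eqF// scale1r addNr.
  have -> : a *m (a0^-1 *: - b) + b = 0.
    by rewrite aE mul_scalar_mx scalerA divff ?gt_eqF// scale1r addNr.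
  by rewrite mul0mx add0r -scalemxAl mulNmx scalerN addrC.
have C'pos : posdef C'.
  split; first by rewrite /C' linearB/= linearZ/= trmx_mul trmxK Csym.
  (* The form of [S] at [u] equals the form of [C'] at [v], which transfers positivity. *)
  move=> v v0; pose u := row_mx (0 : 'rV[R]_1) v *m L.
  have u0 : u != 0.
    rewrite /u mul_row_block row_mx_eq0 negb_and !mul0mx !add0r mulmx1.
    by rewrite v0 orbT.
  have := Spos' u u0; rewrite /u.
  have -> : row_mx 0 v *m L *m S' *m (row_mx 0 v *m L)^T =
      row_mx 0 v *m (L *m S' *m L^T) *m (row_mx 0 v)^T by rewrite trmx_mul !mulmxA.
  rewrite LSL mul_row_block tr_row_mx mul_row_col.
  by rewrite !mul0mx !mulmx0 trmx0 mulmx0 !add0r.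
have [W' W'C] := IH C' C'pos.
pose D : 'M[R]_(1 + d) := block_mx ((Num.sqrt a0)^-1)%:M 0 0 W'.
exists (D *m L).
have -> : D *m L *m S *m (D *m L)^T = D *m (L *m S' *m L^T) *m D^T.
  by rewrite trmx_mul !mulmxA.
rewrite LSL.
rewrite /D tr_block_mx !trmx0 !mulmx_block !mul0mx !mulmx0 !addr0 !add0r ?mulmx0
  ?mul0mx.
rewrite W'C aE tr_scalar_mx -!scalar_mxM.
have -> : (Num.sqrt a0)^-1 * a0 * (Num.sqrt a0)^-1 = 1.
  by rewrite mulrC mulrA -invfM -expr2 sqr_sqrtr ?ltW// mulVf// gt_eqF.
by rewrite -scalar_mx_block.
Qed.
End whitening.

(** * Expectations of cosines *)

Section cos_expectation.
Context {R : realType}.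

(* The family [L] does not depend on [a]: independence, which factorizes products
   of real functions, can thus be applied to the cosine of a sum. *)
Lemma cos_sum_decomp (I : eqType) (s : seq I) : uniq s -> forall th : R,
  exists L : seq (R * (I -> R)), forall a : I -> R,
    cos (\sum_(i <- s) a i + th) =
      \sum_(c <- L) c.1 * \prod_(i <- s) cos (a i + c.2 i).
Proof.
elim: s => [_ th|i s IH /=/andP[nis us] th].
  by exists [:: (cos th, fun=> 0)] => a; rewrite big_seq1 !big_nil mulr1 add0r.
(* In [cos (a + b) = cos a * cos b - sin a * sin b] the last term is rewritten as
   [cos (a + pi / 2) * cos (b - pi / 2)], so that only shifted cosines occur. *)
have [L1 H1] := IH us th; have [L2 H2] := IH us (th - pi / 2).
pose upd (x : R) (c : R * (I -> R)) := (c.1, fun j => if j == i then x else c.2 j).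
exists ([seq upd 0 c | c <- L1] ++ [seq upd (pi / 2) c | c <- L2]) => a.
have E x L : \sum_(c <- [seq upd x c | c <- L]) c.1 * \prod_(j <- i :: s) cos
  (a j + c.2 j)
  = cos (a i + x) * \sum_(c <- L) c.1 * \prod_(j <- s) cos (a j + c.2 j).
  rewrite big_map mulr_sumr; apply: eq_bigr => c _.
  rewrite big_cons/= eqxx mulrCA; congr (_ * (_ * _)).
  apply: eq_big_seq => j js; case: eqP => // ji.
  by rewrite -ji js in nis.
rewrite big_cat/= !E -H1 -H2 big_cons addr0 cosDpihalf addrA cosBpihalf.
by rewrite -addrA cosD mulNr.
Qed.

Context {dO : measure_display} {O : measurableType dO}.
Variable P : probability O R.

Lemma Rintegral_sum_bdd (I : Type) (r : seq I) (F : I -> O -> R) :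
  (forall i, measurable_fun setT (F i)) -> (forall i, bdd_fun (F i)) ->
  \int[P]_w (\sum_(i <- r) F i w) = \sum_(i <- r) \int[P]_w F i w.
Proof.
move=> mF bF; elim: r => [|i r IH].
  under eq_Rintegral do rewrite big_nil.
  by rewrite big_nil Rintegral_cst// mul0r.
have bs : bdd_fun (fun w => \sum_(j <- r) F j w).
  elim: r {IH} => [|j r IH].
    by under eq_fun do rewrite big_nil; exact: bdd_fun_cst.
  by under eq_fun do rewrite big_cons; exact: bdd_funD.
under eq_Rintegral do rewrite big_cons.
rewrite big_cons RintegralD ?IH//; apply: integrable_bdd => //.
exact: measurable_sum.
Qed.

(** The same decomposition is used twice: forwards on the random [Z i], then, after integrating each
    product, backwards on the numbers [m i]. *)
Lemma expectation_cos_sum (I : finType) (S : {set I}) (Z : I -> O -> R)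
    (m k : I -> R) (g : O -> R) (c th : R) :
  (forall i, measurable_fun setT (Z i)) -> measurable_fun setT g -> bdd_fun g ->
  (forall t : I -> R, \int[P]_w (g w * \prod_(i in S) cos (Z i w + t i)) =
     c * \prod_(i in S) (k i * cos (m i + t i))) ->
  \int[P]_w (g w * cos (\sum_(i in S) Z i w + th)) =
  c * \prod_(i in S) k i * cos (\sum_(i in S) m i + th).
Proof.
move=> mZ mg bg H.
have [L HL] := cos_sum_decomp (enum_uniq S) th.
have sE (a : I -> R) : cos (\sum_(i in S) a i + th) =
  \sum_(c <- L) c.1 * \prod_(i in S) cos (a i + c.2 i).
  rewrite -big_enum HL; apply: eq_bigr => b _; by rewrite big_enum.
under eq_Rintegral do rewrite sE mulr_sumr.
have mc i (x : R) : measurable_fun setT (fun w => cos (Z i w + x)).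
  apply: measurableT_comp; first exact:
    continuous_measurable_fun (@continuous_cos R).
  exact: measurable_funD.
have mp (b : R * (I -> R)) :
  measurable_fun setT (fun w => g w * \prod_(i in S) cos (Z i w + b.2 i)).
  by apply: measurable_funM => //; under eq_fun do rewrite -big_enum; exact:
    measurable_prod.
have bp (b : R * (I -> R)) :
  bdd_fun (fun w => g w * \prod_(i in S) cos (Z i w + b.2 i)).
  by apply: bdd_funM => //; apply: bdd_fun_prod => i; exact: bdd_fun_cos.
under eq_Rintegral do under eq_bigr do rewrite mulrCA.
rewrite Rintegral_sum_bdd; last 2 first.
- by move=> b; exact: measurable_funM.
- by move=> b; apply: bdd_funM => //; exact: bdd_fun_cst.
rewrite sE mulr_sumr; apply: eq_bigr => b _.
rewrite RintegralZl//; last exact: integrable_bdd.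
by rewrite H big_split/=; ring.
Qed.

Lemma qform1E d (u v : 'rV[R]_d) : qform 1%:M u v = \sum_i u 0 i * v 0 i.
Proof. by rewrite /qform mulmx1 mxE; apply: eq_bigr => i _; rewrite mxE. Qed.

Lemma gaussian_cos d (X : O -> 'rV[R]_d) (mu : 'rV[R]_d) (S : 'M[R]_d)
  (v : 'rV[R]_d) (th : R) :
  posdef S -> gaussian_vec P X mu S ->
  \int[P]_w cos (qform 1%:M (X w) v + th) =
  expR (- (qform S v v / 2)) * cos (qform 1%:M mu v + th).
Proof.
(* [gaussian_vec] speaks of nonzero projections only, and the zero one is constant. *)
move=> [_ Spos] [mX gX]; have [->|v0] := eqVneq v 0.
  have q0 A u : qform A u (0 : 'rV[R]_d) = 0 by rewrite /qform trmx0 mulmx0 mxE.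
  under eq_Rintegral do rewrite q0.
  rewrite !q0 mul0r oppr0 expR0 mul1r Rintegral_cst//.
  by rewrite [X in fine X](_ : _ = 1%E) ?mulr1//; exact: probability_setT.
pose Y w := qform 1%:M (X w) v.
have mY : measurable_fun setT Y.
  rewrite /Y; under eq_fun do rewrite qform1E.
  by apply: measurable_sum => i; exact: measurable_funM.
set m := qform 1%:M mu v; set s := Num.sqrt (qform S v v).
have s0 : 0 < s by rewrite sqrtr_gt0 Spos.
pose f (x : R) := cos (x + th).
have mf : measurable_fun setT f.
  apply: measurableT_comp; first exact:
    continuous_measurable_fun (@continuous_cos R).
  exact: measurable_funD.
have mY' : measurable_fun [set: O] (Y : O -> measurableTypeR R) by exact: mY.
pose Yp : {RV P >-> measurableTypeR R} :=
  HB.pack (Y : O -> measurableTypeR R) (isMeasurableFun.Build _ _ _ _ _ mY').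
have e : \int[P]_w f (Y w) = \int[normal_prob m s]_x f x.
  rewrite /Rintegral; congr fine.
  rewrite -[LHS](@integral_distribution _ _ _ _ _ P Yp (EFin \o f))//.
  - by apply: eq_measure_integral => A mA _; exact: gX.
  - exact/measurable_EFinP.
  - by apply: (@integrable_bdd _ _ _ P (f \o Y));
      [exact: measurableT_comp|exact: bdd_fun_cos].
rewrite [LHS]e Rintegral_normal_prob; last first.
  by apply: (@integrable_bdd _ _ _ (normal_prob m s)) => //; exact: bdd_fun_cos.
rewrite -[X in - (X / 2)](@sqr_sqrtr _ (qform S v v)) ?(ltW (Spos _ _))// -/s.
have := @Rintegral_cos_normal_pdf R m s (m + th) s0 1.
rewrite expr1n mulr1 => <-; apply: eq_Rintegral => x _.
by rewrite mul1r addrA subrK.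
Qed.

End cos_expectation.

(** * The likelihood ratio in whitened coordinates *)

Section whitened_means.
Context {R : realType} (T n d : nat) (mu : 'rV[R]_d) (W : 'M[R]_d).

(** Centred batch sums scaled by [1 / sqrt n], so that the entries have unit variance under the null
    hypothesis. *)
Definition whiten (x : 'I_T -> 'I_n -> 'rV[R]_d) : 'M[R]_(T, d) :=
  \matrix_(t < T) ((Num.sqrt n%:R)^-1 *: \sum_k ((x t k - mu) *m W^T)).

(** Recovers the observations from the whitened batches; since it is continuous, a test function of
    the former is a test function of the latter. *)
Definition unwhiten (V : 'M[R]_(T, d)) : 'M[R]_(T, d) :=
  \matrix_(t < T) (((n * t.+1)%:R)^-1 *: \sum_(j < T | (j <= t)%N)
    (n%:R *: mu + Num.sqrt n%:R *: (row j V *m (invmx W)^T))).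

Lemma whitenK x : (0 < n)%N -> W \in unitmx -> unwhiten (whiten x) = cum_means x.
Proof.
move=> n0 uW; apply/row_matrixP => t; rewrite !rowK; congr (_ *: _).
have s0 : Num.sqrt (n%:R : R) != 0 by rewrite sqrtr_eq0 -ltNge ltr0n.
apply: eq_bigr => j _; rewrite rowK -scalemxAl scalerA divff// scale1r.
rewrite -mulmx_suml -mulmxA -trmx_mul mulVmx// trmx1 mulmx1 sumrB.
by rewrite sumr_const card_ord scaler_nat [LHS]addrC subrK.
Qed.

Lemma batch_mean_cum_means (x : 'I_T -> 'I_n -> 'rV[R]_d) (t : 'I_T) : (0 < n)%N ->
  batch_mean (cum_means x) t = n%:R^-1 *: \sum_k x t k.
Proof.
move=> n0; rewrite /batch_mean !rowK.
have nN : (n%:R : R) != 0 by rewrite pnatr_eq0 -lt0n.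
have E (s : nat) : (s.+1%:R : R) * ((n * s.+1)%:R)^-1 = n%:R^-1.
  by rewrite natrM invfM mulrCA divff ?mulr1// pnatr_eq0.
rewrite scalerA E (bigD1 t)//= scalerDr -addrA -[RHS]addr0; congr (_ + _).
apply/eqP; rewrite subr_eq0; apply/eqP.
(* At [t = 0] the row [ord_prev t] is row 0 itself, and the factor [0] discards it, as the
   convention for the empty mean demands. *)
have [t0|tpos] := posnP t.
  rewrite t0 scale0r big1 ?scaler0// => j /andP[].
  by rewrite leqn0 -(inj_eq val_inj)/= t0 => ->.
rewrite scalerA /= -{2}(prednK tpos) E; congr (_ *: _); apply: eq_bigl => j.
by rewrite -(inj_eq val_inj)/= andbC -ltn_neqAle -{1}(prednK tpos).
Qed.

Lemma unitmx_whitening (S : 'M[R]_d) : W *m S *m W^T = 1%:M -> W \in unitmx.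
Proof. by rewrite -mulmxA => /mulmx1_unit[]. Qed.

Lemma qform_invmx_whitening (S : 'M[R]_d) (u v : 'rV[R]_d) : W *m S *m W^T = 1%:M ->
  qform (invmx S) u v = qform 1%:M (u *m W^T) (v *m W^T).
Proof.
move=> WS; have WS' : S *m (W^T *m W) = 1%:M.
  by rewrite mulmxA; apply: mulmx1C; rewrite mulmxA.
have -> : invmx S = W^T *m W.
  have [uS _] := mulmx1_unit WS'.
  by rewrite -[RHS]mul1mx -(mulVmx uS) -mulmxA WS' mulmx1.
by rewrite /qform mulmx1 trmx_mul trmxK !mulmxA.
Qed.

(* The density of N(zeta / sqrt n, (n - 1) / n) with respect to N(0, 1), with the
   square completed so that boundedness is visible. *)
Definition lratio (zeta v : R) : R :=
  expR (zeta ^+ 2 / 2 - ln ((n - 1)%:R / n%:R) / 2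
        - (v - Num.sqrt n%:R * zeta) ^+ 2 / (2 * (n - 1)%:R)).

(** In whitened coordinates [N] becomes [v i / sqrt n], the forms become sums of products, and
    [d / 2] spreads the logarithm evenly over the coordinates; each summand is then a completed
    square. *)
Lemma expR_logLR (S : 'M[R]_d) (z : 'rV[R]_d) (tau : 'I_T) x :
  (2 <= n)%N -> W *m S *m W^T = 1%:M ->
  expR (logLR n mu S z tau (cum_means x)) =
  \prod_i lratio (((z - mu) *m W^T) 0 i) (whiten x tau i).
Proof.
move=> n2 WS; have n0 : (0 < n)%N by exact: ltnW.
rewrite /lratio -expR_sum; congr expR; rewrite /logLR.
rewrite !(qform_invmx_whitening _ _ WS) !qform1E.
set zeta := (z - mu) *m W^T; set v := whiten x tau.
have nN : 0 < (n%:R : R) by rewrite ltr0n.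
have s0 : Num.sqrt (n%:R : R) != 0 by rewrite sqrtr_eq0 -ltNge.
have m0 : ((n - 1)%:R : R) != 0 by rewrite pnatr_eq0 subn_eq0 -ltnNge.
have sn : (n%:R : R) = Num.sqrt n%:R ^+ 2 by rewrite sqr_sqrtr ?ltW.
have Nv i : ((batch_mean (cum_means x) tau - mu) *m W^T) 0 i =
  (Num.sqrt n%:R)^-1 * v i.
  have -> : v i = row tau (whiten x) 0 i by rewrite [RHS]mxE.
  rewrite batch_mean_cum_means// rowK -mulmx_suml sumrB sumr_const card_ord.
  have -> : n%:R^-1 *: (\sum_k x tau k) - mu = n%:R^-1 *:
    (\sum_k x tau k - mu *+ n).
    by rewrite scalerBr -(scaler_nat n mu) scalerA mulVf ?scale1r ?gt_eqF.
  rewrite -scalemxAl; set M := _ *m _; rewrite [LHS]mxE [in RHS]mxE.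
  by rewrite [RHS]mulrA -invfM -expr2 -sn.
under eq_bigr do rewrite Nv.
under [X in _ + _ * X - _]eq_bigr do rewrite Nv.
have m1 : ((n - 1)%:R : R) = Num.sqrt n%:R ^+ 2 - 1 by rewrite natrB// -sn.
have -> : - (d%:R / 2) * ln ((n - 1)%:R / n%:R) =
  \sum_(i < d) (- (ln ((n - 1)%:R / n%:R) / 2) : R).
  by rewrite sumr_const card_ord -mulr_natl; field.
rewrite !mulr_sumr mulr_suml -sumrB -big_split -sumrB/=; apply: eq_bigr => i _.
move: (ln _) => l; rewrite m1 in m0 *.
(* With an opaque [s] and [n = s ^ 2], the goal is a rational identity in [s]. *)
have [s sE] : exists s, s = Num.sqrt (n%:R : R) by eexists.
rewrite -sE in sn s0 m0 *; rewrite sn.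
by field; rewrite m0 s0.
Qed.

End whitened_means.

Lemma continuous_mx_coord {R : realType} (T : topologicalType) p q
  (g : T -> 'M[R]_(p, q)) :
  (forall i j, continuous (fun x => g x i j)) -> continuous g.
Proof.
move=> cg x A [B xB BA]; apply: filterS BA _ => /=.
have : \forall y \near x, forall i j, B i j (g y i j).
  apply: filter_forall => i; apply: filter_forall => j.
  exact: (cg i j x _ (xB i j)).
by [].
Qed.

Lemma continuous_unwhiten {R : realType} T n d (mu : 'rV[R]_d) (W : 'M[R]_d) :
  continuous (@unwhiten R T n d mu W).
Proof.
apply: continuous_mx_coord => t i.
have -> : (fun V : 'M[R]_(T, d) => unwhiten n mu W V t i) = (fun V =>
   ((n * t.+1)%:R)^-1 * \sum_(j < T | (j <= t)%N)
    (n%:R * mu 0 i + Num.sqrt n%:R * \sum_k (invmx W)^T k i * V j k)).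
  apply/funext => V; rewrite !mxE summxE; congr (_ * _); apply: eq_bigr => j _.
  rewrite !mxE; congr (_ + _ * _); apply: eq_bigr => k _; rewrite !mxE mulrC//.
apply: continuous_mulcr; apply: continuous_sumr => j.
apply: continuous_addcr; apply: continuous_mulcr; apply: continuous_sumr => k.
exact/continuous_mulcr/coord_continuous.
Qed.

Section lratio.
Context {R : realType} (n : nat).
Hypothesis n2 : (2 <= n)%N.

Lemma lratio_bdd (zeta : R) : bdd_fun (lratio n zeta).
Proof.
exists (expR (zeta ^+ 2 / 2 - ln ((n - 1)%:R / n%:R) / 2)) => v.
by rewrite ger0_norm ?expR_ge0// ler_expR gerDl oppr_le0 divr_ge0 ?sqr_ge0.
Qed.

Lemma continuous_lratio (zeta : R) : continuous (lratio n zeta).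
Proof.
move=> v; apply: continuous_comp; last exact: continuous_expR.
apply: cvgB; first exact: cvg_cst.
apply: cvgM; last exact: cvg_cst.
apply: (cvg_comp (fun v => v - Num.sqrt n%:R * zeta) (fun x => x ^+ 2));
  last exact: exprn_continuous.
by apply: cvgB; [exact: cvg_id|exact: cvg_cst].
Qed.

(** The logarithmic term of [lratio] is the ratio of the two peaks; the rest compares quadratic
    exponents. *)
Lemma lratio_normal_pdf (zeta v : R) :
  lratio n zeta v * normal_pdf 0 1 v =
  normal_pdf (zeta / Num.sqrt n%:R) (Num.sqrt ((n - 1)%:R / n%:R)) v.
Proof.
have nN : 0 < (n%:R : R) by rewrite ltr0n ltnW.
have m0 : 0 < ((n - 1)%:R : R) by rewrite ltr0n subn_gt0.
have c0 : 0 < ((n - 1)%:R / n%:R : R) by rewrite divr_gt0.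
have sc0 : 0 < Num.sqrt ((n - 1)%:R / n%:R : R) by rewrite sqrtr_gt0.
rewrite !normal_pdfE ?oner_neq0 ?gt_eqF//.
have sE : Num.sqrt ((n - 1)%:R / n%:R : R) = expR (ln ((n - 1)%:R / n%:R) / 2).
  rewrite -[X in Num.sqrt X](lnK c0) [X in expR X]splitr expRD -expr2 sqrtr_sqr.
  by rewrite ger0_norm// expR_ge0.
have pE : normal_peak (Num.sqrt ((n - 1)%:R / n%:R : R)) =
   expR (- (ln ((n - 1)%:R / n%:R) / 2)) * normal_peak 1.
  rewrite /normal_peak -mulrnAr sqrtrM ?sqr_ge0// sqrtr_sqr ger0_norm ?ltW//.
  by rewrite expr1n mul1r invfM sE expRN.
rewrite pE /lratio /normal_fun [LHS]mulrCA -expRD [RHS]mulrAC -expRD [RHS]mulrC.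
congr (_ * expR _); rewrite sqr_sqrtr ?ltW//; move: (ln _) => l.
have sn : (n%:R : R) = Num.sqrt n%:R ^+ 2 by rewrite sqr_sqrtr ?ltW.
have s0 : Num.sqrt (n%:R : R) != 0 by rewrite sqrtr_eq0 -ltNge.
have m1 : ((n - 1)%:R : R) = Num.sqrt n%:R ^+
  2 - 1 by rewrite natrB ?(ltnW n2)// -sn.
rewrite m1 in m0 *.
have [s sE'] : exists s, s = Num.sqrt (n%:R : R) by eexists.
rewrite -sE' in sn s0 m0 *; rewrite sn.
by field; rewrite s0 gt_eqF.
Qed.

End lratio.

(** * Tilting a standard normal coordinate *)

Section tilting.
Context {R : realType}.

Lemma measurable_cos_comp (d : measure_display) (O : measurableType d)
  (f : O -> R) :
  measurable_fun setT f -> measurable_fun setT (fun w => cos (f w)).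
Proof. exact: measurableT_comp (continuous_measurable_fun (@continuous_cos R)). Qed.

Lemma cosDcos (a b : R) : cos (a + b) = cos a * cos b +
  cos (a + pi / 2) * cos (b - pi / 2).
Proof. by rewrite cosD cosDpihalf cosBpihalf mulNr. Qed.

Lemma continuous_cos_affine (u eta : R) :
  continuous (fun x : R => cos (u * x + eta)).
Proof.
move=> x; apply: continuous_comp; last exact: continuous_cos.
by apply: cvgD; [apply: cvgM; [exact: cvg_cst|exact: cvg_id]|exact: cvg_cst].
Qed.

Lemma Rintegral_normal_cos_ratio (m s : R) (r : R -> R) (u eta : R) : 0 < s ->
  continuous r -> bdd_fun r ->
    (forall x, r x * normal_pdf 0 1 x = normal_pdf m s x) ->
  \int[normal_prob 0 1]_x (cos (u * x + eta) * r x) =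
  expR (- (s ^+ 2 * u ^+ 2 / 2)) * cos (u * m + eta).
Proof.
move=> s0 cr br rE; rewrite Rintegral_normal_prob; last first.
  apply: (@integrable_bdd _ _ _ (normal_prob 0 1)).
    apply: continuous_measurable_fun => x; apply: cvgM; last exact: cr.
    exact: continuous_cos_affine.
  by apply: bdd_funM => //; exact: bdd_fun_cos.
rewrite -(@Rintegral_cos_normal_pdf R m s (u * m + eta) s0 u); apply:
  eq_Rintegral => x _.
by rewrite -mulrA rE mulrBr addrA subrK.
Qed.

Lemma Rintegral_normal_cos (u eta : R) :
  \int[normal_prob 0 1]_x cos (u * x + eta) = expR (- (u ^+ 2 / 2)) * cos eta.
Proof.
have := @Rintegral_normal_cos_ratio 0 1 (fun=> 1) u eta ltr01
  (@cst_continuous _ _ _)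
  (bdd_fun_cst _ _) (fun x => mul1r _).
rewrite expr1n mul1r mulr0 add0r => <-; apply: eq_Rintegral => x _.
by rewrite mulr1.
Qed.

Context {dO : measure_display} {O : measurableType dO}.
Variable P : probability O R.

Section step.
Variables (V b rho : O -> R) (K a : R).
Hypotheses (mV : measurable_fun setT V) (mb : measurable_fun setT b).
Hypotheses (mrho : measurable_fun setT rho) (brho : bdd_fun rho).
Hypothesis HV : forall u th, \int[P]_w (cos (b w + u * V w + th) * rho w) =
  expR (- (u ^+ 2 / 2)) * K * cos (a + th).

Let icos u th : P.-integrable setT
  (EFin \o (fun w => cos (b w + u * V w + th) * rho w)).
Proof.
apply: integrable_bdd; last by apply: bdd_funM => //; exact: bdd_fun_cos.
apply: measurable_funM => //; apply: measurable_cos_comp; apply: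
  measurable_funD => //.
by apply: measurable_funD => //; exact: measurable_funM.
Qed.

Let mg th : measurable_fun setT (fun w => cos (b w + th) * rho w).
Proof.
apply: measurable_funM => //; apply: measurable_cos_comp.
exact: measurable_funD.
Qed.

Let bg th : bdd_fun (fun w => cos (b w + th) * rho w).
Proof. by apply: bdd_funM => //; exact: bdd_fun_cos. Qed.

(* The hypothesis [HV] on cosines says that [V] is standard normal and independent
   of the signed weights [cos (b + th) * rho]. *)
Lemma standard_normal_factor (phi : R -> R) th : continuous phi -> bdd_fun phi ->
  \int[P]_w (phi (V w) * (cos (b w + th) * rho w)) =
  (\int[normal_prob 0 1]_x phi x) * (K * cos (a + th)).
Proof.
move=> cphi bphi.
have mphi := continuous_measurable_fun cphi.
rewrite -RintegralZr//; last first.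
  by apply: (@integrable_bdd _ _ _ (normal_prob 0 1)).
have /= := @cos_uniqueness R 1 1 _ _ P _ _ (normal_prob 0 1)
  (fun w => const_mx (V w)) (fun x => const_mx x)
  (fun w => cos (b w + th) * rho w) (fun=> K * cos (a + th))
  _ _ (mg th) (bg th) _ _ _ (fun M => phi (M 0 0)).
have -> : (fun w :
  O => (phi ((const_mx (V w) : 'M[R]_(1, 1)) 0 0) * (cos (b w + th) * rho w)))
  = (fun w => phi (V w) * (cos (b w + th) * rho w)).
  by apply/funext => w; rewrite mxE.
under [X in (_ -> _ -> _ -> _ -> _ -> _ -> _ -> _ = X) -> _]eq_Rintegral do
  rewrite mxE.
apply.
- by move=> i j; under eq_fun do rewrite mxE.
- by move=> i j; under eq_fun do rewrite mxE; exact: measurable_id.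
- exact: measurable_cst.
- exact: bdd_fun_cst.
- move=> A eta.
  have dotE (v : R) : mxdot A (const_mx v) =
    A 0 0 * v by rewrite /mxdot !big_ord1 mxE.
  set u := A 0 0 in dotE *.
  (* The product of two cosines splits into frequencies [u] and [- u], both covered by [HV]; as its
     factor is even in [u], the two terms recombine. *)
  transitivity (\int[P]_w (2^-1 * (cos (b w + u * V w + (th + eta)) * rho w) +
                           2^-1 * (cos (b w + (- u) * V w + (th - eta)) * rho w))).
    apply: eq_Rintegral => w _;
      rewrite dotE mulrA [cos _ * cos _]mulrC cosMcos mulrDl !mulrA.
    by congr (_ * cos _ * _ + _ * cos _ * _); ring.
  rewrite RintegralD//; last 2 first.
  - by rewrite /comp; under eq_fun do rewrite EFinM; apply: integrableZl => //;
      exact: icos.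
  - by rewrite /comp; under eq_fun do rewrite EFinM; apply: integrableZl => //;
      exact: icos.
  rewrite !RintegralZl// ?HV; try exact: icos.
  under [RHS]eq_Rintegral do rewrite dotE.
  rewrite RintegralZr//; last first.
    apply: (@integrable_bdd _ _ _ (normal_prob 0 1)); last exact: bdd_fun_cos.
    exact: (continuous_measurable_fun (@continuous_cos_affine _ _)).
  rewrite Rintegral_normal_cos sqrrN.
  transitivity (expR (- (u ^+ 2 / 2)) * K * (2^-1 * cos ((a + th) + eta) +
    2^-1 * cos ((a + th) - eta))).
    by rewrite !addrA; ring.
  by rewrite -cosMcos; ring.
- by move=> x; apply: continuous_comp; [exact: coord_continuous|exact: cphi].
- by have [N pN] := bphi; exists N.
Qed.

(** The addition formula separates [V] from [b]; in each of the two products [V] integrates as a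
    standard normal variable weighted by [r], that is as N(m, s ^ 2), and the formula is then
    undone. *)
Lemma expectation_cos_tilt (m s : R) (r : R -> R) (u th : R) : 0 < s ->
  continuous r -> bdd_fun r ->
    (forall x, r x * normal_pdf 0 1 x = normal_pdf m s x) ->
  \int[P]_w (cos (b w + u * V w + th) * (rho w * r (V w))) =
  expR (- (s ^+ 2 * u ^+ 2 / 2)) * K * cos (a + u * m + th).
Proof.
move=> s0 cr br rE.
pose phi eta x := cos (u * x + eta) * r x.
have cphi eta : continuous (phi eta).
  by move=> x; apply: cvgM; [exact: continuous_cos_affine|exact: cr].
have bphi eta : bdd_fun (phi eta) by apply: bdd_funM => //; exact: bdd_fun_cos.
have i eta th' : P.-integrable setT
  (EFin \o (fun w => phi eta (V w) * (cos (b w + th') * rho w))).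
  apply: integrable_bdd.
    apply: measurable_funM => //; apply: measurableT_comp => //.
    exact: continuous_measurable_fun.
  by apply: bdd_funM => //; have [N pN] := bphi eta; exists N.
transitivity (\int[P]_w (phi 0 (V w) * (cos (b w + th) * rho w) +
    phi (pi / 2) (V w) * (cos (b w + (th - pi / 2)) * rho w))).
  apply: eq_Rintegral => w _.
  have -> : b w + u * V w + th = u * V w + (b w + th) by ring.
  by rewrite /phi addr0 (addrA (b w) th) (cosDcos (u * V w)); ring.
rewrite RintegralD// !standard_normal_factor//.
rewrite !(Rintegral_normal_cos_ratio _ _ s0 cr br rE) addr0.
have -> : a + u * m + th = u * m + (a + th) by ring.
by rewrite (addrA a th) (cosDcos (u * m) (a + th)); ring.
Qed.
End step.
End tilting.

(** * The whitened batch means *)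

Section batches.
Context {R : realType} (T n d : nat) (mu : 'rV[R]_d) (Sigma : 'M[R]_d).
Hypothesis hn : (2 <= n)%N.
Hypothesis hSigma : posdef Sigma.
Context {dO : measure_display} {O : measurableType dO}.
Variable P : probability O R.
Variable X : 'I_T -> 'I_n -> O -> 'rV[R]_d.
Hypothesis hgauss : forall t k, gaussian_vec P (X t k) mu Sigma.
Hypothesis hindep : indep_family P (fun p : 'I_T * 'I_n => X p.1 p.2).
Variable W : 'M[R]_d.
Hypothesis WS : W *m Sigma *m W^T = 1%:M.

Let sn0 : (Num.sqrt (n%:R : R)) != 0.
Proof. by rewrite sqrtr_eq0 -ltNge ltr0n ltnW. Qed.

Let sn2 : Num.sqrt (n%:R : R) ^+ 2 = n%:R.
Proof. by rewrite sqr_sqrtr. Qed.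

Let nn0 : (n%:R : R) != 0.
Proof. by rewrite pnatr_eq0 -lt0n ltnW. Qed.

Let x w : 'I_T -> 'I_n -> 'rV[R]_d := fun t k => X t k w.

Let vec (A : 'M[R]_(T, d)) (p : 'I_T * 'I_n) : 'rV[R]_d :=
  (Num.sqrt n%:R)^-1 *: (row p.1 A *m W).

Let Z A (p : 'I_T * 'I_n) (y : 'rV[R]_d) :=
  qform 1%:M y (vec A p) - qform 1%:M mu (vec A p).

Let Z_E A p y : Z A p y =
  (Num.sqrt n%:R)^-1 * \sum_i A p.1 i * ((y - mu) *m W^T) 0 i.
Proof.
rewrite /Z /vec /= /qform !mulmx1.
have -> : (y *m ((Num.sqrt n%:R)^-1 *: (row p.1 A *m W))^T) 0 0 -
   (mu *m ((Num.sqrt n%:R)^-1 *: (row p.1 A *m W))^T) 0 0 =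
   ((y - mu) *m ((Num.sqrt n%:R)^-1 *: (row p.1 A *m W))^T) 0 0.
  by rewrite mulmxBl [in RHS]mxE [X in _ = _ + X]mxE.
rewrite linearZ/= -scalemxAr trmx_mul mulmxA [LHS]mxE; congr (_ * _).
by rewrite [LHS]mxE; apply: eq_bigr => i _; rewrite !mxE mulrC.
Qed.

Lemma mxdot_whiten A (y : 'I_T -> 'I_n -> 'rV[R]_d) :
  mxdot A (whiten mu W y) = \sum_(p : 'I_T * 'I_n) Z A p (y p.1 p.2).
Proof.
rewrite -(pair_bigA _ (fun t k => Z A (t, k) (y t k)))/= /mxdot; apply:
  eq_bigr => t _.
under [RHS]eq_bigr do rewrite Z_E/=.
rewrite -mulr_sumr exchange_big/= mulr_sumr; apply: eq_bigr => i _.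
by rewrite !mxE summxE -mulr_sumr mulrCA.
Qed.

(** The characteristic factor [expR (- v / 2)] of one point, where [v] is the variance of its
    projection on [vec A p]. *)
Let kappa (A : 'M[R]_(T, d)) (p : 'I_T * 'I_n) : R :=
  expR (- (\sum_i A p.1 i ^+ 2 / n%:R / 2)).

Let qform_vec A p : qform Sigma (vec A p) (vec A p) = \sum_i A p.1 i ^+ 2 / n%:R.
Proof.
rewrite /vec /qform linearZ/= -!scalemxAl -scalemxAr scalerA -invfM -expr2 sn2.
rewrite trmx_mul -!mulmxA (mulmxA W) (mulmxA (W *m Sigma)) WS mul1mx mxE mulrC mxE
  mulr_suml.
by apply: eq_bigr => i _; rewrite !mxE expr2.
Qed.

Let Z_cos A p t : \int[P]_w cos (Z A p (X p.1 p.2 w) + t) = kappa A p * cos t.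
Proof.
under eq_Rintegral do rewrite -addrA.
rewrite (gaussian_cos _ _ hSigma (hgauss _ _)) qform_vec mulr_suml addrA subrr
  add0r.
by [].
Qed.

Let continuous_Zcos A p t : continuous (fun y => cos (Z A p y + t)).
Proof.
move=> y; apply: continuous_comp; last exact: continuous_cos.
have -> : (fun y => Z A p y + t) =
  (fun y => (t - qform 1%:M mu (vec A p)) + mxdot (vec A p) y).
  apply/funext => y'; rewrite /Z qform1E /mxdot big_ord1 addrAC -addrA addrC;
    congr (_ + _).
  by apply: eq_bigr => i _; rewrite mulrC.
exact/continuous_addcr/continuous_mxdot.
Qed.

Let mX t k i : measurable_fun setT (fun w => X t k w 0 i).
Proof. by have [] := hgauss t k. Qed.

Let mZ A p : measurable_fun setT (fun w => Z A p (X p.1 p.2 w)).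
Proof.
apply: measurable_funB => //; under eq_fun do rewrite qform1E.
by apply: measurable_sum => i; exact: measurable_funM.
Qed.

Let prod_indep A (S : {set 'I_T * 'I_n}) (t : 'I_T * 'I_n -> R) :
  (\int[P]_w (\prod_(p in S) cos (Z A p (X p.1 p.2 w) + t p))%:E =
  (\prod_(p in S) (kappa A p * cos (t p)))%:E)%E.
Proof.
rewrite (hindep S (fun p => @continuous_Zcos A p (t p)) (fun p => bdd_fun_cos _)).
rewrite -prodEFin; apply: eq_bigr => p _; rewrite EFin_Rintegral_bdd ?Z_cos//.
  by apply: measurable_cos_comp; apply: measurable_funD => //; exact: mZ.
exact: bdd_fun_cos.
Qed.

Let measurable_prod_cos A (S : {set 'I_T * 'I_n}) (t : 'I_T * 'I_n -> R) :
  measurable_fun setT (fun w => \prod_(p in S) cos (Z A p (X p.1 p.2 w) + t p)).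
Proof.
under eq_fun do rewrite -big_enum; apply: measurable_prod => p _.
by apply: measurable_cos_comp; apply: measurable_funD => //; exact: mZ.
Qed.

Let prod_kappa A : \prod_p kappa A p = expR (- (mxdot A A / 2)).
Proof.
rewrite -(pair_bigA _ (fun t k => kappa A (t, k)))/= /kappa/=.
under eq_bigr do rewrite prodr_const card_ord -expRM_natl.
rewrite -expR_sum; congr expR; rewrite /mxdot mulr_suml -sumrN; apply:
  eq_bigr => t _.
rewrite mulr_suml mulrN mulr_sumr; congr (- _); apply: eq_bigr => i _.
by rewrite -expr2; field.
Qed.

Lemma whiten_cos A th :
  \int[P]_w cos (mxdot A (whiten mu W (x w)) + th) =
    expR (- (mxdot A A / 2)) * cos th.
Proof.
have sT (F : 'I_T * 'I_n -> R) : \sum_(p in finset.setT) F p = \sum_p F p.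
  by apply: eq_bigl => p; rewrite finset.in_setT.
have pT (F : 'I_T * 'I_n -> R) : \prod_(p in finset.setT) F p = \prod_p F p.
  by apply: eq_bigl => p; rewrite finset.in_setT.
have dE w : mxdot A (whiten mu W (x w)) = \sum_p Z A p (X p.1 p.2 w).
  exact: mxdot_whiten.
have := @expectation_cos_sum R _ _ P _ finset.setT (fun p w => Z A p (X p.1 p.2 w))
  (fun=> 0) (kappa A) (fun=> 1) 1 th (mZ A) (@measurable_cst _ _ _ _ _ _)
    (bdd_fun_cst _ _).
under eq_Rintegral do rewrite mul1r sT -dE.
rewrite sT pT mul1r prod_kappa big1// add0r; apply => t.
under eq_Rintegral do rewrite mul1r.
under [in RHS]eq_bigr do rewrite add0r.
by rewrite mul1r; apply: EFin_inj; rewrite -EFin_Rintegral_bdd ?prod_indep//;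
  apply: bdd_fun_prod => p; exact: bdd_fun_cos.
Qed.

Lemma measurable_whiten t i : measurable_fun setT (fun w => whiten mu W (x w) t i).
Proof.
under eq_fun do rewrite !mxE summxE.
apply: measurable_funM => //; apply: measurable_sum => k.
under eq_fun do rewrite mxE; apply: measurable_sum => j.
apply: measurable_funM => //; under eq_fun do rewrite !mxE.
by apply: measurable_funB => //; exact: mX.
Qed.

(** * The alternative: one point of batch [tau] replaced by [z] *)

Section replaced.
Variables (J : O -> 'I_n) (z : 'rV[R]_d) (tau : 'I_T).
Hypothesis hJunif : uniform_label P J.
Hypothesis hJindep : indep_label P (fun p : 'I_T * 'I_n => X p.1 p.2) J.
Let zeta := (z - mu) *m W^T.
Let ind k w : R := (J w == k)%:R.

Let measurable_ind k : measurable_fun setT (ind k).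
Proof.
have [mJ _] := hJunif k.
have -> : ind k = \1_[set w | J w = k].
  apply/funext => w; rewrite /ind indicE; congr (nat_of_bool _)%:R.
  by apply/idP/idP => [/eqP h|]; rewrite inE//= => ->.
exact: measurable_indic.
Qed.

Let bdd_ind k : bdd_fun (ind k).
Proof. by exists 1 => w; rewrite /ind normr_nat lern1 leq_b1. Qed.

Let mxdot_whiten_replace A k y :
  mxdot A (whiten mu W (replace_point y tau k z)) =
  \sum_(p in finset.setC (finset.set1 (tau, k))) Z A p (y p.1 p.2) +
    \sum_i A tau i * (zeta 0 i / Num.sqrt n%:R).
Proof.
rewrite mxdot_whiten (bigD1 (tau, k))//= addrC; congr (_ + _).
- apply: eq_big => p; first by rewrite !inE.
  by case: p => t j /negPf; rewrite /replace_point xpair_eqE/= => ->.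
- rewrite /replace_point !eqxx/= Z_E mulr_sumr; apply: eq_bigr => i _.
  by rewrite -/zeta mulrCA (mulrC _^-1).
Qed.

(** Dropping the factor of the replaced point lowers the variance in row [tau] from 1 to
    [1 - 1 / n]; the outcome is free of [k]. *)
Let prod_kappa_replace A k :
  \prod_(p in finset.setC (finset.set1 (tau, k))) kappa A p =
  expR (- (mxdot A A / 2) + \sum_i A tau i ^+ 2 / n%:R / 2).
Proof.
rewrite expRD -prod_kappa [X in _ = X * _](bigD1 (tau, k))//= [RHS]mulrC mulrA.
rewrite [X in X * _]mulrC -expRD addNr expR0 mul1r.
by apply: eq_bigl => p; rewrite !inE.
Qed.

(** For a fixed label the replaced point is a constant, moved into the phase; independence of label
    and points extracts the probability [1 / n]. *)
Let replace_cos_label A th k :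
  \int[P]_w (ind k w * cos (mxdot A (whiten mu W (replace_point (x w) tau k z)) +
    th)) =
  n%:R^-1 * (expR (- (mxdot A A / 2) + \sum_i A tau i ^+ 2 / n%:R / 2) *
    cos (\sum_i A tau i * (zeta 0 i / Num.sqrt n%:R) + th)).
Proof.
have := @expectation_cos_sum R _ _ P _ (finset.setC (finset.set1 (tau, k)))
  (fun p w => Z A p (X p.1 p.2 w)) (fun=> 0) (kappa A) (ind k) n%:R^-1
  (\sum_i A tau i * (zeta 0 i / Num.sqrt n%:R) + th) (mZ A) (measurable_ind k)
    (bdd_ind k).
have dE w : \sum_(p in finset.setC (finset.set1 (tau, k))) Z A p (X p.1 p.2 w) +
    (\sum_i A tau i * (zeta 0 i / Num.sqrt n%:R) + th) =
    mxdot A (whiten mu W (replace_point (x w) tau k z)) + th.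
  by rewrite mxdot_whiten_replace addrA.
under eq_Rintegral do rewrite dE.
rewrite [X in cos (X + _)]big1// add0r prod_kappa_replace -mulrA; apply => t.
under [in RHS]eq_bigr do rewrite add0r.
apply: EFin_inj; rewrite -EFin_Rintegral_bdd; last 2 first.
- exact: measurable_funM.
- by apply: bdd_funM => //; apply: bdd_fun_prod => p; exact: bdd_fun_cos.
rewrite (hJindep _ k (fun p => @continuous_Zcos A p (t p))
  (fun p => bdd_fun_cos _)).
by rewrite prod_indep (hJunif k).2 -EFinM.
Qed.

Lemma measurable_whiten_replace_at k t i :
  measurable_fun setT (fun w => whiten mu W (replace_point (x w) tau k z) t i).
Proof.
under eq_fun do rewrite !mxE summxE.
apply: measurable_funM => //; apply: measurable_sum => j.
under eq_fun do rewrite mxE; apply: measurable_sum => l.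
apply: measurable_funM => //; under eq_fun do rewrite !mxE.
apply: measurable_funB => //; rewrite /replace_point.
by case: (_ && _) => //; exact: mX.
Qed.

(** Trades the random index for fixed labels, for which measurability and independence are at
    hand. *)
Lemma label_split (F : 'I_n -> O -> R) w : F (J w) w = \sum_k ind k w * F k w.
Proof.
rewrite (bigD1 (J w))//= /ind eqxx mul1r big1 ?addr0// => k /negPf kJ.
by rewrite eq_sym kJ mul0r.
Qed.

Lemma measurable_whiten_replace t i :
  measurable_fun setT (fun w => whiten mu W (replace_point (x w) tau (J w) z) t i).
Proof.
under eq_fun do rewrite
  (label_split (fun k w => whiten mu W (replace_point (x w) tau k z) t i)).
apply: measurable_sum => k; apply: measurable_funM => //.
exact: measurable_whiten_replace_at.
Qed.

Lemma replace_cos A th :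
  \int[P]_w cos (mxdot A (whiten mu W (replace_point (x w) tau (J w) z)) + th) =
  expR (- (mxdot A A / 2) + \sum_i A tau i ^+ 2 / n%:R / 2) *
    cos (\sum_i A tau i * (zeta 0 i / Num.sqrt n%:R) + th).
Proof.
under eq_Rintegral do rewrite
  (label_split (fun k w => cos
  (mxdot A (whiten mu W (replace_point (x w) tau k z)) + th))).
rewrite Rintegral_sum_bdd; last 2 first.
- move=> k; apply: measurable_funM => //.
  apply: (measurable_trig (measurable_whiten_replace_at k) (trig_cos A th)).
- by move=> k; apply: bdd_funM => //; exact: bdd_fun_cos.
under eq_bigr do rewrite replace_cos_label.
by rewrite sumr_const card_ord -[LHS]mulr_natl mulrA divff// mul1r.
Qed.

Let V w := whiten mu W (x w).
Let r i (v : R) := lratio n (zeta 0 i) v.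

(** Coordinates are tilted one by one, each adding its variance defect to the exponent and its mean
    to the phase. [A] stays general because the step needs the induction hypothesis with an
    arbitrary entry at [(tau, i)]. *)
Lemma tilted_cos (s : seq 'I_d) : uniq s -> forall A th,
  \int[P]_w (cos (mxdot A (V w) + th) * \prod_(i <- s) r i (V w tau i)) =
  expR (- (mxdot A A / 2) + \sum_(i <- s) A tau i ^+ 2 / n%:R / 2) *
    cos (\sum_(i <- s) A tau i * (zeta 0 i / Num.sqrt n%:R) + th).
Proof.
elim: s => [_ A th|i s IH /=/andP[nis us] A th].
  under eq_Rintegral do rewrite big_nil mulr1.
  by rewrite !big_nil addr0 add0r; exact: whiten_cos.
(* Clearing this entry isolates the coordinate about to be tilted: [mxdot A' (V w)] no longer
   involves it. *)
pose u := A tau i; pose A' := A - u *: delta_mx tau i.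
have A'i : A' tau i = 0 by rewrite !mxE !eqxx mulr1 subrr.
have A'j v j : j \in s -> (A' + v *: delta_mx tau i) tau j = A tau j.
  move=> js; rewrite !mxE eqxx/=; case: eqP => [ji|_];
    last by rewrite !mulr0 subr0 addr0.
  by rewrite -ji js in nis.
have AE : A = A' + u *: delta_mx tau i by rewrite subrK.
have AA v : mxdot (A' + v *: delta_mx tau i) (A' + v *: delta_mx tau i) =
  mxdot A' A' + v ^+ 2.
  by rewrite mxdot_sqrDdelta A'i mulr0 addr0.
have m0 : 0 < ((n - 1)%:R : R) by rewrite ltr0n subn_gt0.
have nN : 0 < (n%:R : R) by rewrite ltr0n ltnW.
pose sg := Num.sqrt ((n - 1)%:R / n%:R : R).
have sg0 : 0 < sg by rewrite sqrtr_gt0 divr_gt0.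
have sg2 : sg ^+ 2 = 1 - n%:R^-1.
  by rewrite sqr_sqrtr ?divr_ge0 ?ltW// natrB ?(ltnW hn)// mulrBl divff// mul1r.
have mVi j : measurable_fun setT (fun w => V w tau j) by exact: measurable_whiten.
have mr j : measurable_fun setT (fun w => r j (V w tau j)).
  apply: measurableT_comp => //; apply: continuous_measurable_fun.
  exact: continuous_lratio.
have br j : bdd_fun (fun w => r j (V w tau j)).
  by have [N rN] := lratio_bdd n (zeta 0 j); exists N => w; exact: rN.
have := @expectation_cos_tilt R _ _ P (fun w => V w tau i) (fun w => mxdot A' (V w))
  (fun w => \prod_(j <- s) r j (V w tau j))
  (expR (- (mxdot A' A' / 2) + \sum_(j <- s) A tau j ^+ 2 / n%:R / 2))
  (\sum_(j <- s) A tau j * (zeta 0 j / Num.sqrt n%:R)) _ _ _ _ _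
  (zeta 0 i / Num.sqrt n%:R) sg (r i) u th sg0 _ _ _.
have dE v w : mxdot A' (V w) + v * V w tau i =
  mxdot (A' + v *: delta_mx tau i) (V w).
  by rewrite mxdotDl mxdotZdelta.
under eq_Rintegral do rewrite dE -AE.
under [X in _ -> X = _]eq_Rintegral do rewrite big_cons (mulrC (r i _)).
rewrite big_cons => -> //.
- rewrite -expRD big_cons; congr (expR _ * cos (_ + _)); last by rewrite addrC.
  by rewrite AE AA -AE sg2 -/u; field.
- apply: measurable_sum => t; apply: measurable_sum => j; apply:
    measurable_funM => //.
  exact: measurable_whiten.
- by apply: measurable_prod.
- exact: bdd_fun_prod.
- move=> v th'; under eq_Rintegral do rewrite dE.
  rewrite IH// AA -expRD; congr (expR _ * cos (_ + _)).
  + rewrite (eq_big_seq (fun j => A tau j ^+ 2 / n%:R / 2)) => [|j js];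
      last by rewrite A'j.
    by rewrite addrA; congr (_ + _); field.
  + by apply: eq_big_seq => j js; rewrite A'j.
- exact: continuous_lratio.
- exact: lratio_bdd.
- exact: lratio_normal_pdf.
Qed.

(** With all coordinates tilted, [tilted_cos] gives exactly the value of [replace_cos], and cosines
    suffice. *)
Lemma replaced_whiten_density (h : 'M[R]_(T, d) -> R) : continuous h -> bdd_fun h ->
  \int[P]_w h (whiten mu W (replace_point (x w) tau (J w) z)) =
  \int[P]_w (h (V w) * \prod_i lratio n (zeta 0 i) (V w tau i)).
Proof.
move=> ch bh; transitivity
  (\int[P]_w (h (whiten mu W (replace_point (x w) tau (J w) z)) * 1)).
  by apply: eq_Rintegral => w _; rewrite mulr1.
apply: cos_uniqueness => //.
- exact: measurable_whiten_replace.
- exact: measurable_whiten.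
- exact: bdd_fun_cst.
- apply: measurable_prod => i _; apply: measurableT_comp; last exact:
    measurable_whiten.
  by apply: continuous_measurable_fun; exact: continuous_lratio.
- apply: bdd_fun_prod => i; have [N rN] := lratio_bdd n (zeta 0 i).
  by exists N => w; exact: rN.
- move=> A th; rewrite tilted_cos ?index_enum_uniq// -replace_cos.
  by apply: eq_Rintegral => w _; rewrite mulr1.
Qed.

End replaced.
End batches.

(* exp(logLR) is the density (Radon-Nikodym derivative) of the law of
   (hatmu_1,...,hatmu_T) under H1^tau w.r.t. its law under H0: the two laws
   agree when tested against every bounded continuous f. *)
Theorem theorem3p1 (R : realType) (T n d : nat)
  (hT : (1 <= T)%N) (hn : (2 <= n)%N) (hd : (1 <= d)%N)
  (mu : 'rV[R]_d) (Sigma : 'M[R]_d) (hSigma : posdef Sigma)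
  (z : 'rV[R]_d) (tau : 'I_T)
  (dO : measure_display) (O : measurableType dO) (P : probability O R)
  (X : 'I_T -> 'I_n -> O -> 'rV[R]_d) (J : O -> 'I_n)
  (hgauss : forall t k, gaussian_vec P (X t k) mu Sigma)
  (hindep : indep_family P (fun p : 'I_T * 'I_n => X p.1 p.2))
  (hJunif : uniform_label P J)
  (hJindep : indep_label P (fun p : 'I_T * 'I_n => X p.1 p.2) J) :
  forall f : 'M[R]_(T, d) -> R, continuous f -> bdd_fun f ->
  (\int[P]_w
      (f (cum_means (replace_point (fun t k => X t k w) tau (J w) z)))%:E
   = \int[P]_w
      (f (cum_means (fun t k => X t k w))
       * expR (logLR n mu Sigma z tau (cum_means (fun t k => X t k w))))%:E)%E.
Proof.
have [W WS] := whitening hSigma; have n0 : (0 < n)%N by exact: ltnW.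
have uW := unitmx_whitening WS.
move=> f cf bf.
pose h V := f (unwhiten n mu W V).
have ch : continuous h.
  by move=> V; apply: continuous_comp; [exact: continuous_unwhiten|exact: cf].
have bh : bdd_fun h by have [N fN] := bf; exists N => V; exact: fN.
have mV := measurable_whiten hgauss W.
have fE (y : 'I_T -> 'I_n -> 'rV[R]_d) : f (cum_means y) =
  h (whiten mu W y) by rewrite /h whitenK.
under eq_integral do rewrite fE.
under [RHS]eq_integral do rewrite fE (expR_logLR _ _ _ _ hn WS).
rewrite !EFin_Rintegral_bdd; last 4 first.
- apply: measurable_funM; first exact: (measurable_continuous_mx mV ch bh).
  apply: measurable_prod => i _; apply: measurableT_comp; last exact: mV.
  by apply: continuous_measurable_fun; exact: continuous_lratio.
- apply: bdd_funM; first by have [N hN] := bh; exists N.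
  apply: bdd_fun_prod => i; have [N rN] := lratio_bdd n (((z - mu) *m W^T) 0 i).
  by exists N => w; exact: rN.
- exact: (measurable_continuous_mx
    (measurable_whiten_replace hgauss W z tau hJunif) ch bh).
- by have [N hN] := bh; exists N.
congr EFin.
exact: (replaced_whiten_density hn hSigma hgauss hindep WS z tau hJunif hJindep ch
  bh).
Qed.
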